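(* Let $(\mathbb{R}^n,g)$ be a pseudo-Euclidean space, $n\ge3$, with coordinates $x=(x_1,\dots,x_n)$ and $g_{ij}=\delta_{ij}\varepsilon_i$. Consider smooth functions $f(\xi)$, $h(\xi)$ and $\varphi(\xi)$, where $\xi=\sum_{i=1}^n\alpha_ix_i$, $\alpha_i\in\mathbb{R}$, and $\sum_{i=1}^n\varepsilon_i\alpha_i^2=\varepsilon_{i_0}$, given by $$\begin{cases}f(\xi)=c_1[(a-N)\xi+c]^{-\frac1{a-N}}\\ h(\xi)=c_2[(a-N)\xi+c]^{-\frac{N}{a-N}}\\ \varphi(\xi)=c_3[(a-N)\xi+c]^{-\frac{k}{a-N}}\end{cases}$$ with $k,c_1,c_2,c_3,N\in\mathbb{R}$, $k,c_1,c_2,c_3>0$, $c\in\mathbb{R}$, $$N=\frac{a^2-b}{2(k+a)},\qquad k+a\neq0,\qquad r=1,$$ $a=(n-2)k-m$ and $b=m(2k+1)-(n-2)k^2$. Then $(\mathbb{R}^n\times_fF^m,\widetilde g,h)$ is a quasi-Einstein semi-Riemannian manifold with $r=1$ and $\rho=0$, i.e. $$\mathrm{Ric}_{\widetilde g}-\frac1h\mathrm{Hess}_{\widetilde g}h=0,$$ where $\widetilde g=\overline g+f^2g_F$, $\overline g=\frac1{\varphi^2}g$ and $F$ is Ricci-flat. These solutions are defined on the half space defined by $\sum_{i=1}^n\alpha_ix_i>-\frac{2c(k+a)}{a^2+b+2ka}$.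
   Context: Here $\varepsilon_i=\pm1$, $\varepsilon_{i_0}\in\{1,-1\}$, and $(F^m,g_F)$ is a semi-Riemannian manifold of dimension $m\ge1$. The warped product $\mathbb{R}^n\times_fF^m$ is the product of the base (the part of $\mathbb{R}^n$ where the functions are defined, with metric $\overline g$) and $F$, with the metric $\widetilde g=\overline g+f^2g_F$; functions on the base are regarded as functions on the product via the projection. A semi-Riemannian manifold $(M,\widetilde g)$ with a smooth function $h$ is quasi-Einstein if $\mathrm{Ric}_{\widetilde g}-\frac rh\mathrm{Hess}_{\widetilde g}h=\rho\,\widetilde g$ for a constant $\rho\in\mathbb{R}$.
   Formalization: The stated half space is correct only for k+a>0; for k+a<0 the base (a−N)ξ+c is negative there (n=3, m=7, k=2 gives a sixth root of a negative number), so the solutions are taken where (a−N)ξ+c>0, which for k+a<0 is the opposite half space. *)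

(* Defs.v *)
From HB Require Import structures.
From mathcomp Require Import all_boot all_order all_algebra.
From mathcomp Require Import all_classical all_reals all_analysis.

Set Implicit Arguments.
Unset Strict Implicit.
Unset Printing Implicit Defensive.
Import Order.TTheory GRing.Theory Num.Theory.
Import numFieldNormedType.Exports.
Local Open Scope classical_set_scope.
Local Open Scope ring_scope.

(* Meaningful for open [D]. *)
Fixpoint Ck_on (R : realType) (d : nat) (k : nat) (D : set 'rV[R]_d)
    (f : 'rV[R]_d -> R) : Prop :=
  (forall x, D x -> {for x, continuous f}) /\
  match k with
  | 0%N => True
  | k'.+1 => forall i : 'I_d,
      (forall x, D x -> derivable f x 'e_i) /\ Ck_on k' D (fun x => 'D_'e_i f x)
  end.

Definition smooth_on (R : realType) (d : nat) (D : set 'rV[R]_d)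
    (f : 'rV[R]_d -> R) : Prop := forall k, Ck_on k D f.

(* [christoffel G l i j] is Gamma^l_{ij}. *)
Definition christoffel (R : realType) (d : nat) (G : 'rV[R]_d -> 'M[R]_d)
    (l i j : 'I_d) (x : 'rV[R]_d) : R :=
  2^-1 * \sum_(s < d) invmx (G x) l s *
    ('D_'e_i (fun y => G y j s) x + 'D_'e_j (fun y => G y i s) x
     - 'D_'e_s (fun y => G y i j) x).

(* The coefficient of d_l in R(d_i, d_j) d_k, where
   R(X, Y) Z = nabla_X nabla_Y Z - nabla_Y nabla_X Z - nabla_[X, Y] Z. *)
Definition riemann (R : realType) (d : nat) (G : 'rV[R]_d -> 'M[R]_d)
    (l i j k : 'I_d) (x : 'rV[R]_d) : R :=
  'D_'e_i (christoffel G l j k) x - 'D_'e_j (christoffel G l i k) x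
  + \sum_(p < d) (christoffel G p j k x * christoffel G l i p x
                  - christoffel G p i k x * christoffel G l j p x).

(* Ric(Y, Z) is the trace of X |-> R(X, Y) Z; round spheres have positive Ric. *)
Definition ricci (R : realType) (d : nat) (G : 'rV[R]_d -> 'M[R]_d)
    (x : 'rV[R]_d) : 'M[R]_d :=
  \matrix_(j, k) \sum_(l < d) riemann G l l j k x.

Definition hessian (R : realType) (d : nat) (G : 'rV[R]_d -> 'M[R]_d)
    (h : 'rV[R]_d -> R) (x : 'rV[R]_d) : 'M[R]_d :=
  \matrix_(i, j) ('D_'e_i (fun y => 'D_'e_j h y) x
                  - \sum_(l < d) christoffel G l i j x * 'D_'e_l h x).

(* The manifold is the open subset [points] of [ambient]; an abstract manifold M
   is the case [ambient = M], [points = setT].  The metric is given by its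
   components in each chart.  Nothing is assumed of these data here: the axioms
   are gathered in [smooth_atlas] and [metric_tensor].  [coord i], [param i] and
   [metric i] are relevant only on [chart_dom i], [chart_cod i], [chart_cod i]. *)
Record chart_data (R : realType) (d : nat) := ChartData {
  ambient : topologicalType;
  points : set ambient;
  chart : Type;
  chart_dom : chart -> set ambient;
  coord : chart -> ambient -> 'rV[R]_d;
  param : chart -> 'rV[R]_d -> ambient;
  metric : chart -> 'rV[R]_d -> 'M[R]_d
}.

Arguments ambient {R d}.
Arguments points {R d}.
Arguments chart {R d}.
Arguments chart_dom {R d}.
Arguments coord {R d}.
Arguments param {R d}.
Arguments metric {R d}.

Definition chart_cod (R : realType) (d : nat) (X : chart_data R d)
    (i : chart X) : set 'rV[R]_d := coord X i @` chart_dom X i.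
Arguments chart_cod {R d} X i.

Definition overlap (R : realType) (d : nat) (X : chart_data R d)
    (i j : chart X) : set 'rV[R]_d :=
  coord X i @` (chart_dom X i `&` chart_dom X j).
Arguments overlap {R d} X i j.

Definition transition (R : realType) (d : nat) (X : chart_data R d)
    (i j : chart X) : 'rV[R]_d -> 'rV[R]_d := coord X j \o param X i.
Arguments transition {R d} X i j.

Record smooth_atlas (R : realType) (d : nat) (X : chart_data R d) : Prop := {
  atlas_hausdorff : hausdorff_space (ambient X);
  atlas_second_countable : @second_countable (ambient X);
  atlas_points_open : open (points X);
  atlas_cover : points X = \bigcup_(i : chart X) chart_dom X i;
  atlas_dom_open : forall i, open (chart_dom X i);
  atlas_cod_open : forall i, open (chart_cod X i);
  atlas_coordK : forall i p, chart_dom X i p -> param X i (coord X i p) = p;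
  atlas_coord_continuous : forall i p, chart_dom X i p ->
    {for p, continuous (coord X i)};
  atlas_param_continuous : forall i x, chart_cod X i x ->
    {for x, continuous (param X i)};
  atlas_transition : forall i j (q : 'I_d),
    smooth_on (overlap X i j) (fun x => transition X i j x 0 q)
}.

(* [S] has an orthonormal basis (the rows of [P]) exactly [nu] vectors of which
   are timelike. *)
Definition has_index (R : realType) (d : nat) (S : 'M[R]_d) (nu : nat) : Prop :=
  exists (P : 'M[R]_d) (T : {set 'I_d}),
    [/\ P \in unitmx, #|T| = nu
      & P *m S *m P^T = diag_mx (\row_i (if i \in T then -1 else 1))].

(* Rows are indexed by the source coordinates, as in the library's ['J]. *)
Definition jacobian_mx (R : realType) (d : nat) (tau : 'rV[R]_d -> 'rV[R]_d)
    (x : 'rV[R]_d) : 'M[R]_d :=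
  \matrix_(p, q) 'D_'e_p (fun y => tau y 0 q) x.

Record metric_tensor (R : realType) (d : nat) (X : chart_data R d) : Prop := {
  metric_smooth : forall i (p q : 'I_d),
    smooth_on (chart_cod X i) (fun x => metric X i x p q);
  metric_sym : forall i x, chart_cod X i x -> (metric X i x)^T = metric X i x;
  metric_nondegenerate : forall i x, chart_cod X i x -> metric X i x \in unitmx;
  metric_index : exists nu, forall i x, chart_cod X i x ->
    has_index (metric X i x) nu;
  metric_transition : forall i j x, overlap X i j x ->
    metric X i x = jacobian_mx (transition X i j) x
                   *m metric X j (transition X i j x)
                   *m (jacobian_mx (transition X i j) x)^T
}.

Definition semi_riemannian (R : realType) (d : nat) (X : chart_data R d) : Prop :=
  smooth_atlas X /\ metric_tensor X.

Definition smooth_fun (R : realType) (d : nat) (X : chart_data R d)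
    (h : ambient X -> R) : Prop :=
  forall i, smooth_on (chart_cod X i) (h \o param X i).
Arguments smooth_fun {R d} X h.

Definition ricci_flat (R : realType) (d : nat) (X : chart_data R d) : Prop :=
  forall i x, chart_cod X i x -> ricci (metric X i) x = 0.

(* [h] is required not to vanish, as the equation divides by it. *)
Definition quasi_einstein (R : realType) (d : nat) (X : chart_data R d)
    (h : ambient X -> R) (r rho : R) : Prop :=
  [/\ semi_riemannian X, smooth_fun X h, (forall p, points X p -> h p != 0)
    & forall i x, chart_cod X i x ->
        ricci (metric X i) x
        - (r / h (param X i x)) *: hessian (metric X i) (h \o param X i) x
        = rho *: metric X i x].
Arguments quasi_einstein {R d} X h r rho.

Definition euclidean_domain (R : realType) (n : nat) (U : set 'rV[R]_n)
    (G : 'rV[R]_n -> 'M[R]_n) : chart_data R n :=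
  @ChartData R n 'rV[R]_n U unit (fun=> U) (fun=> id) (fun=> id) (fun=> G).

Definition warped_product (R : realType) (n m : nat) (B : chart_data R n)
    (f : ambient B -> R) (F : chart_data R m) : chart_data R (n + m) :=
  @ChartData R (n + m) (ambient B * ambient F)%type
    (points B `*` points F)
    (chart B * chart F)%type
    (fun ij => chart_dom B ij.1 `*` chart_dom F ij.2)
    (fun ij p => row_mx (coord B ij.1 p.1) (coord F ij.2 p.2))
    (fun ij y => (param B ij.1 (lsubmx y), param F ij.2 (rsubmx y)))
    (fun ij y => block_mx
       (metric B ij.1 (lsubmx y)) 0
       0 (f (param B ij.1 (lsubmx y)) ^+ 2 *: metric F ij.2 (rsubmx y))).
Arguments warped_product {R n m} B f F.

(* Main.v *)
(* In the variable u = (a - N) xi + c, which is affine on the base, phi, f and h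
   are constant multiples of the powers u^(-k/lam), u^(-1/lam) and u^(-N/lam),
   lam = a - N.  So the warped metric has the form
     p0 u^mu diag(eps) + w0 u^nu g_F,
   and its Christoffel symbols, Ricci tensor and the Hessian of a power of u are
   explicit.  As g_F is Ricci-flat, Ric - (1/h) Hess h is a combination of
   u^-2 beta_i beta_j, u^-2 eps_i delta_ij (beta the gradient of u) and a power
   of u times g_F.  The coefficients of the last two are proportional to the same
   affine expression, which vanishes by the definition of a; that of the first is
   (a^2 - b - 2 N (k + a)) / lam^2, which vanishes by the choice of N.  Finally
   2 (k + a) lam = a^2 + b + 2 k a = a^2 + (n - 2) k^2 + m > 0, so lam is
   nonzero and has the sign of k + a. *)

Require Import Defs.
From HB Require Import structures.
From mathcomp Require Import all_boot all_order all_algebra.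
From mathcomp Require Import all_classical all_reals all_analysis.
From mathcomp Require Import ring lra.

Set Implicit Arguments.
Unset Strict Implicit.
Unset Printing Implicit Defensive.
Import Order.TTheory GRing.Theory Num.Theory.
Import numFieldNormedType.Exports.
Local Open Scope classical_set_scope.
Local Open Scope ring_scope.

(** * Topology of products and row vectors *)

(** A neighbourhood of a matrix contains a box of neighbourhoods of its entries, and a filter
    absorbs the finite intersection over the entries. *)
Lemma cvg_mx (T U : topologicalType) (p q : nat)
    (f : T -> 'M[U]_(p, q)) (x : T) :
  (forall i j, f y i j @[y --> x] --> f x i j) -> f y @[y --> x] --> f x.
Proof.
move=> fc A [P Pn PA].
have : \forall y \near x, forall i j, P i j (f y i j).
  by apply: filter_forall => i; apply: filter_forall => j; exact: fc (Pn i j).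
by apply: filterS => y; exact: PA.
Qed.

Lemma mx_coord_continuous (U : topologicalType) (p q : nat) (i : 'I_p) (j : 'I_q) :
  continuous (fun A : 'M[U]_(p, q) => A i j).
Proof.
move=> A S AS; exists (fun i' j' => if (i' == i) && (j' == j) then S else setT).
  by move=> i' j'; case: ifPn => [/andP[/eqP-> /eqP->]//|_]; exact: filterT.
by move=> B /(_ i j); rewrite /= !eqxx.
Qed.

Lemma lsubmx_continuous (U : topologicalType) (p q1 q2 : nat) :
  continuous (@lsubmx U p q1 q2).
Proof.
move=> A; apply: cvg_mx => i j; rewrite mxE.
by under eq_fun do rewrite mxE; exact: mx_coord_continuous.
Qed.

Lemma rsubmx_continuous (U : topologicalType) (p q1 q2 : nat) :
  continuous (@rsubmx U p q1 q2).
Proof.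
move=> A; apply: cvg_mx => i j; rewrite mxE.
by under eq_fun do rewrite mxE; exact: mx_coord_continuous.
Qed.

Lemma cvg_row_mx (T U : topologicalType) (p q1 q2 : nat)
    (f : T -> 'M[U]_(p, q1)) (g : T -> 'M[U]_(p, q2)) (x : T) :
  f y @[y --> x] --> f x -> g y @[y --> x] --> g x ->
  row_mx (f y) (g y) @[y --> x] --> row_mx (f x) (g x).
Proof.
move=> fc gc; apply: (@cvg_mx _ _ _ _ (fun y => row_mx (f y) (g y))) => i j.
rewrite mxE; under eq_fun do rewrite mxE.
case: (fintype.split j) => j'.
  exact: (cvg_comp _ _ fc (@mx_coord_continuous _ _ _ i j' (f x))).
exact: (cvg_comp _ _ gc (@mx_coord_continuous _ _ _ i j' (g x))).
Qed.

Lemma hausdorff_prod (T U : topologicalType) :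
  hausdorff_space T -> hausdorff_space U -> hausdorff_space (T * U)%type.
Proof.
move=> hT hU [a b] [a' b'] ab; congr pair.
  apply: hT => A B aA bB.
  have [[s t] [/= sA sB]] : (A `*` setT) `&` (B `*` (@setT U)) !=set0.
    by apply: ab; [exists (A, setT)|exists (B, setT)] => //=; split => //; exact: filterT.
  by exists s; split; [case: sA|case: sB].
apply: hU => A B aA bB.
have [[s t] [/= sA sB]] : (setT `*` A) `&` ((@setT T) `*` B) !=set0.
  by apply: ab; [exists (setT, A)|exists (setT, B)] => //=; split => //; exact: filterT.
by exists t; split; [case: sA|case: sB].
Qed.

Lemma open_setX (T U : topologicalType) (A : set T) (B : set U) :
  open A -> open B -> open (A `*` B).
Proof.
move=> oA oB; rewrite openE => -[a b] [/= Aa Bb].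
by exists (A, B) => //=; split; exact: open_nbhs_nbhs.
Qed.

Lemma second_countable_prod (T U : topologicalType) :
  @second_countable T -> @second_countable U -> @second_countable (T * U)%type.
Proof.
move=> [BT cT [oT bT]] [BU cU [oU bU]].
exists ((fun AB : set T * set U => AB.1 `*` AB.2) @` (BT `*` BU)).
  by apply: card_le_trans (card_image_le _ _) _; exact: countableX.
split=> [_ [[A B] [/= BA BB] <-]|[x y] S [[A B] [/= xA yB] ABS]].
  by apply: open_setX; [exact: oT|exact: oU].
have [A' [BA' xA'] sA] := bT x A xA.
have [B' [BB' yB'] sB] := bU y B yB.
exists (A' `*` B'); first by split => //; exists (A', B').
by move=> [s t] [/= /sA As /sB Bt]; apply: ABS.
Qed.


(** The countable basis consists of the balls with rational centre and rational radius. *)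
Lemma second_countable_rV (R : realType) (d : nat) : @second_countable 'rV[R]_d.
Proof.
pose B (qr : 'rV[rat]_d * rat) : set 'rV[R]_d :=
  @ball R 'rV[R]_d (map_mx ratr qr.1) (ratr qr.2).
exists (B @` setT).
  by apply: card_le_trans (card_image_le _ _) _; exact: countableP.
split=> [_ [qr _ <-]|x S /nbhs_ballP[e /= e0 eS]]; first exact: ball_open.
have e20 : 0 < e / 2 by lra.
(* A radius below e/2 and a centre within that radius of [x] keep the ball inside the e-ball of [x],
   by the triangle inequality. *)
have [r /itvP re] := rat_in_itvoo e20.
have r0 : 0 < ratr r :> R by rewrite re.
have xq (j : 'I_d) : exists q : rat, `|ratr q - x 0 j| < ratr r.
  have xr : x 0 j - ratr r < x 0 j + ratr r by lra.
  have [q /itvP qx] := rat_in_itvoo xr.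
  by exists q; rewrite ltr_distl !qx.
pose q := \row_j projT1 (cid (xq j)).
have xB : B (q, r) x.
  by split=> // i j; rewrite (ord1 i) !mxE; exact: (projT2 (cid (xq j))).
exists (B (q, r)); first by split => //; exists (q, r).
move=> y yB; apply: eS; apply: (@le_ball _ _ _ (ratr r + ratr r)).
  by rewrite [leRHS]splitr lerD // ltW // re.
exact: ball_triangle (ball_sym xB) yB.
Qed.

(** * Derivatives and C^k functions *)

(** Restricting to the line through [x] with direction [v] reduces directional derivatives to one
    real variable. *)
Lemma derive_line (R : numFieldType) (V W : normedModType R) (f : V -> W) (x v : V) :
  'D_v f x = 'D_1 (fun h : R => f (h *: v + x)) 0.
Proof.
rewrite /derive; set g1 := fun h => h^-1 *: _; set g2 := fun h => h^-1 *: _.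
suff -> : g1 = g2 by [].
by apply/funext => h; rewrite /g1 /g2 /= addr0 scale0r add0r [_%:A]mulr1.
Qed.

(** A chain rule under mere directional derivability of [g]: on the line it is the one-variable
    chain rule. *)
Lemma is_derive_comp_scalar (R : realType) (V : normedModType R) (g : V -> R)
    (phi : R -> R) (x v : V) (dg dphi : R) :
  is_derive x v g dg -> is_derive (g x) 1 phi dphi ->
  is_derive x v (phi \o g) (dphi * dg).
Proof.
move=> [/derivable1P g1 gE] phi'.
have ig : is_derive (0 : R) 1 (fun h : R => g (h *: v + x)) dg.
  by apply: DeriveDef => //; rewrite -derive_line.
have iphi : is_derive (g (0 *: v + x) : R) 1 phi dphi by rewrite scale0r add0r.
have [dc dE] := @is_derive1_comp R phi (fun h : R => g (h *: v + x)) 0 _ _ iphi ig.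
by split; [exact: (derivable1P (phi \o g) x v).2|rewrite derive_line].
Qed.

(** The base of every power in the solution has this form, and so do the coordinate functions, with
    [beta] a basis vector. *)
Definition affine (R : realType) (d : nat) (beta : 'rV[R]_d) (c : R)
  (y : 'rV[R]_d) : R := \sum_(i < d) beta 0 i * y 0 i + c.

Lemma is_derive_affine (R : realType) (d : nat) (beta : 'rV[R]_d) (c : R)
    (x : 'rV[R]_d) (i : 'I_d) : is_derive x 'e_i (affine beta c) (beta 0 i).
Proof.
have cv : h^-1 *: ((affine beta c \o shift x) (h *: 'e_i) - affine beta c x)
    @[h --> 0^'] --> beta 0 i.
  (* The difference quotient of an affine function is constant away from [h = 0]. *)
  apply: cvg_near_cst; near=> h.
  have h0 : h != 0 by near: h; exact: nbhs_dnbhs_neq.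
  rewrite /affine /= opprD addrACA subrr addr0 -sumrB (bigD1 i) //= big1 => [|j ji].
    rewrite !mxE !eqxx; move: (beta _ _) (x _ _) => s t.
    by rewrite /GRing.scale /=; field.
  by rewrite !mxE eqxx (negbTE ji) mulr0 add0r subrr.
split; first by apply/cvg_ex; exists (beta 0 i).
exact: cvg_lim cv.
Unshelve. all: by end_near. Qed.

Lemma affine_continuous (R : realType) (d : nat) (beta : 'rV[R]_d) (c : R) :
  continuous (affine beta c).
Proof.
move=> x; pose F := nbhs x.
have ic i : beta 0 i * (y : 'rV[R]_d) 0 i @[y --> F] --> beta 0 i * x 0 i.
  exact: cvgM (cvg_cst _) (@mx_coord_continuous _ _ _ 0 i x).
have sc : \sum_(i < d) beta 0 i * (y : 'rV[R]_d) 0 i @[y --> F] -->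
    \sum_(i < d) beta 0 i * x 0 i.
  by apply: cvg_big => [|i _]; [exact: add_continuous|exact: ic].
exact: cvgD sc (cvg_cst c).
Qed.

Lemma is_derive_powR_affine (R : realType) (d : nat) (beta : 'rV[R]_d)
    (c C s : R) (x : 'rV[R]_d) (i : 'I_d) : 0 < affine beta c x ->
  is_derive x 'e_i (fun y => C * affine beta c y `^ s)
    (C * s * beta 0 i * affine beta c x `^ (s - 1)).
Proof.
move=> x0; have H : is_derive x 'e_i (fun y => C * affine beta c y `^ s) _ :=
  is_derive_comp_scalar (is_derive_affine beta c x i)
    (is_deriveZ C (is_derive1_powR s x0)).
by apply: (is_derive_eq H); rewrite /GRing.scale /=; ring.
Qed.

(** * Derivatives of functions pulled back from the fibre *)

Lemma rsubmx_axpy (R : pzRingType) (p q1 q2 : nat) (h : R) (v x : 'M[R]_(p, q1 + q2)) :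
  rsubmx (h *: v + x) = h *: rsubmx v + rsubmx x.
Proof. by apply/matrixP => i j; rewrite !mxE. Qed.

Lemma rsubmx_delta_rshift (R : pzRingType) (p q : nat) (j : 'I_q) :
  rsubmx ('e_(rshift p j) : 'rV[R]_(p + q)) = 'e_j.
Proof. by apply/rowP => l; rewrite !mxE (inj_eq (@rshift_inj _ _)). Qed.

Lemma rsubmx_delta_lshift (R : pzRingType) (p q : nat) (i : 'I_p) :
  rsubmx ('e_(lshift q i) : 'rV[R]_(p + q)) = 0.
Proof. by apply/rowP => l; rewrite !mxE eq_rlshift andbF. Qed.

Lemma derive_rsub (R : realType) (p q : nat) (g : 'rV[R]_q -> R)
    (x : 'rV[R]_(p + q)) (j : 'I_q) :
  'D_'e_(rshift p j) (g \o rsubmx) x = 'D_'e_j g (rsubmx x).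
Proof.
rewrite /derive; set g1 := fun h => h^-1 *: _; set g2 := fun h => h^-1 *: _.
suff -> : g1 = g2 by [].
by apply/funext => h; rewrite /g1 /g2 /= rsubmx_axpy rsubmx_delta_rshift.
Qed.

Lemma derive_rsub0 (R : realType) (p q : nat) (g : 'rV[R]_q -> R)
    (x : 'rV[R]_(p + q)) (i : 'I_p) :
  'D_'e_(lshift q i) (g \o rsubmx) x = 0.
Proof.
rewrite derive_line (_ : (fun _ => _) = cst (g (rsubmx x))) ?derive_cst //.
by apply/funext => h /=; rewrite rsubmx_axpy rsubmx_delta_lshift scaler0 add0r.
Qed.

Lemma derivable_rsub (R : realType) (p q : nat) (g : 'rV[R]_q -> R)
    (x : 'rV[R]_(p + q)) (j : 'I_q) :
  derivable g (rsubmx x) 'e_j -> derivable (g \o rsubmx) x 'e_(rshift p j).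
Proof.
rewrite /derivable; set g1 := fun h => h^-1 *: _; set g2 := fun h => h^-1 *: _.
suff -> : g1 = g2 by [].
by apply/funext => h; rewrite /g1 /g2 /= rsubmx_axpy rsubmx_delta_rshift.
Qed.

Lemma derivable_rsub0 (R : realType) (p q : nat) (g : 'rV[R]_q -> R)
    (x : 'rV[R]_(p + q)) (i : 'I_p) :
  derivable (g \o rsubmx) x 'e_(lshift q i).
Proof.
apply: (derivable1P (g \o rsubmx) x 'e_(lshift q i)).2.
rewrite (_ : (fun _ => _) = cst (g (rsubmx x))) //.
by apply/funext => h /=; rewrite rsubmx_axpy rsubmx_delta_lshift scaler0 add0r.
Qed.

(** * Closure properties of C^k functions *)

Lemma Ck_on_continuous (R : realType) (d k : nat) (D : set 'rV[R]_d)
    (f : 'rV[R]_d -> R) x : Ck_on k D f -> D x -> {for x, continuous f}.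
Proof. by case: k => [|k] [fc _]; exact: fc. Qed.

Lemma near_eq_continuous_for (T U : topologicalType) (f g : T -> U) (x : T) :
  {near x, f =1 g} -> {for x, continuous f} -> {for x, continuous g}.
Proof.
move=> fg fc; rewrite /prop_for /continuous_at -(nbhs_singleton fg).
by apply: cvg_trans fc; exact: near_eq_cvg.
Qed.

(** Openness of [D] turns agreement on [D] into agreement near each of its points, which derivatives
    respect. *)
Lemma Ck_on_eq (R : realType) (d k : nat) (D : set 'rV[R]_d)
    (f g : 'rV[R]_d -> R) : open D -> (forall x, D x -> f x = g x) ->
  Ck_on k D f -> Ck_on k D g.
Proof.
move=> oD; have nearD (f' g' : 'rV[R]_d -> R) x : (forall x, D x -> f' x = g' x) ->
    D x -> {near x, f' =1 g'}.
  by move=> fg Dx; near=> y; apply: fg; near: y; exact: open_nbhs_nbhs.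
have gc (f' g' : 'rV[R]_d -> R) : (forall x, D x -> f' x = g' x) ->
    (forall x, D x -> {for x, continuous f'}) -> forall x, D x -> {for x, continuous g'}.
  by move=> fg fc x Dx; exact: near_eq_continuous_for (nearD _ _ _ fg Dx) (fc x Dx).
elim: k f g => [|k IHk] f g fg [fc fk]; first by split=> //; exact: gc fc.
split=> [|i]; first exact: gc fc.
have [df Cf] := fk i; split.
  by move=> x Dx; apply: near_eq_derivable (df x Dx); exact: nearD.
apply: IHk Cf => x Dx; apply: near_eq_derive; exact: nearD.
Unshelve. all: by end_near. Qed.

Lemma Ck_onW (R : realType) (d k : nat) (D : set 'rV[R]_d)
    (f : 'rV[R]_d -> R) : Ck_on k.+1 D f -> Ck_on k D f.
Proof.
elim: k f => [|k IHk] f [fc fk]; split=> // i.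
by have [df Cf] := fk i; split=> //; exact: IHk.
Qed.

Lemma Ck_onD (R : realType) (d k : nat) (D : set 'rV[R]_d)
    (f g : 'rV[R]_d -> R) : open D ->
  Ck_on k D f -> Ck_on k D g -> Ck_on k D (fun x => f x + g x).
Proof.
move=> oD; elim: k f g => [|k IHk] f g [fc fk] [gc gk].
  by split=> // x Dx; exact: continuousD (fc x Dx) (gc x Dx).
split=> [x Dx|i]; first exact: continuousD (fc x Dx) (gc x Dx).
have [df Cf] := fk i; have [dg Cg] := gk i; split=> [x Dx|].
  by apply: derivableD; [exact: df|exact: dg].
apply: (Ck_on_eq oD _ (IHk _ _ Cf Cg)) => x Dx.
by rewrite (@deriveD _ _ _ f g x) //; [exact: df|exact: dg].
Qed.

Lemma Ck_onM (R : realType) (d k : nat) (D : set 'rV[R]_d)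
    (f g : 'rV[R]_d -> R) : open D ->
  Ck_on k D f -> Ck_on k D g -> Ck_on k D (fun x => f x * g x).
Proof.
move=> oD; elim: k f g => [|k IHk] f g Ckf Ckg.
  by split=> // x Dx; exact: continuousM (Ck_on_continuous Ckf Dx) (Ck_on_continuous Ckg Dx).
split=> [x Dx|i].
  by exact: continuousM (Ck_on_continuous Ckf Dx) (Ck_on_continuous Ckg Dx).
have [df Cf] := Ckf.2 i; have [dg Cg] := Ckg.2 i; split=> [x Dx|].
  by apply: derivableM; [exact: df|exact: dg].
(* The Leibniz rule leaves one factor undifferentiated in each summand; [Ck_onW] lowers its order to
   that of the induction hypothesis. *)
apply: (Ck_on_eq oD _ (Ck_onD oD (IHk _ _ (Ck_onW Ckf) Cg) (IHk _ _ (Ck_onW Ckg) Cf))) => x Dx.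
by rewrite (@deriveM _ _ f g x) //; [exact: df|exact: dg].
Qed.

Lemma Ck_on_cst (R : realType) (d k : nat) (D : set 'rV[R]_d) (a : R) :
  Ck_on k D (fun=> a).
Proof.
have ac a' : forall x, D x -> {for x, continuous ((fun=> a') : 'rV[R]_d -> R)}.
  by move=> x _; exact: cst_continuous.
elim: k a => [|k IHk] a; first by split=> //; exact: ac.
split=> [|i]; first exact: ac.
split=> [x _|]; first exact: (derivable_cst a x).
by under eq_fun do rewrite derive_cst.
Qed.

(** Base derivatives of a pulled-back function vanish and fibre derivatives are again pulled back,
    so the induction closes. *)
Lemma Ck_on_rsub (R : realType) (p q k : nat) (D : set 'rV[R]_q)
    (f : 'rV[R]_q -> R) :
  Ck_on k D f -> Ck_on k ((@rsubmx R 1 p q) @^-1` D) (f \o rsubmx).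
Proof.
have fc (g : 'rV[R]_q -> R) (x : 'rV[R]_(p + q)) :
    {for rsubmx x, continuous g} -> {for x, continuous (g \o rsubmx)}.
  by move=> gc; apply: continuous_comp gc; exact: rsubmx_continuous.
elim: k f => [|k IHk] f [fcont fk].
  by split=> // x Dx; exact: fc (fcont _ Dx).
split=> [x Dx|i]; first exact: fc (fcont _ Dx).
rewrite -(splitK i); case: (fintype.split i) => j /=.
  split=> [x _|]; first exact: derivable_rsub0.
  by under eq_fun do rewrite derive_rsub0; exact: Ck_on_cst.
have [df Cf] := fk j; split=> [x Dx|]; first by apply: derivable_rsub; exact: df.
by under eq_fun do rewrite derive_rsub; exact: (IHk (fun y => 'D_'e_j f y) Cf).
Qed.

Lemma Ck_on_affine (R : realType) (d k : nat) (D : set 'rV[R]_d) (beta : 'rV[R]_d)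
    (c : R) : Ck_on k D (affine beta c).
Proof.
have iE x i := is_derive_affine beta c x i.
have ac x : D x -> {for x, continuous (affine beta c)}.
  by move=> _; exact: affine_continuous.
case: k => [|k]; first by split=> //; exact: ac.
split=> [|i]; first exact: ac.
split=> [x _|]; first by have [] := iE x i.
under eq_fun => x do have [_ ->] := iE x i.
exact: Ck_on_cst.
Qed.

(** Differentiation only changes the constant [C] and lowers the exponent [s] by one, hence the
    induction runs over all [C] and [s] at once. *)
Lemma Ck_on_powR_affine (R : realType) (d k : nat) (D : set 'rV[R]_d)
    (beta : 'rV[R]_d) (c C s : R) : open D -> (forall x, D x -> 0 < affine beta c x) ->
  Ck_on k D (fun x => C * affine beta c x `^ s).
Proof.
move=> oD D0.
have fc C' s' x : D x -> {for x, continuous (fun x => C' * affine beta c x `^ s')}.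
  move=> Dx; apply: continuousM; first exact: cst_continuous.
  apply: (@continuous_comp _ _ _ (affine beta c) (@powR R ^~ s')).
    exact: affine_continuous.
  apply/differentiable_continuous/derivable1_diffP.
  by have [] := is_derive1_powR s' (D0 x Dx).
elim: k C s => [|k IHk] C s; first by split=> // x; exact: fc.
split=> [x|i]; first exact: fc.
have iE x (Dx : D x) := is_derive_powR_affine C s i (D0 x Dx).
split=> [x Dx|]; first by have [] := iE x Dx.
apply: (Ck_on_eq oD _ (IHk (C * s * beta 0 i) (s - 1))) => x Dx.
by have [_ ->] := iE x Dx.
Qed.

(** * Curvature of a warped product with power-type factors *)

Lemma sum_delta (R : pzRingType) (n : nat) (k : 'I_n) (X : 'I_n -> R) :
  \sum_(i < n) (i == k)%:R * X i = X k.
Proof.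
rewrite (bigD1 k) //= eqxx mul1r big1 ?addr0 // => i /negbTE ->.
by rewrite mul0r.
Qed.

Lemma sum_ord_split (V : nmodType) (n m : nat) (F : 'I_(n + m) -> V) (s t : V) :
  \sum_i F (lshift m i) = s -> \sum_i F (rshift n i) = t -> \sum_i F i = s + t.
Proof. by move=> <- <-; rewrite big_split_ord. Qed.

(** * Algebra of the Christoffel symbols of a conformally flat metric *)

Section ConformalSymbol.
Variables (R : comPzRingType) (n : nat) (eps beta : 'I_n -> R) (E : R).
Hypothesis epsK : forall i, eps i * eps i = 1.
Hypothesis betaE : \sum_i eps i * beta i ^+ 2 = E.

(* The Christoffel symbols of the conformal metric [exp (2 w) eps_i delta_ij],
   where [beta] stands for the gradient of [w]. *)
Definition conf_symbol (p l k : 'I_n) : R :=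
  beta l * (p == k)%:R + beta k * (p == l)%:R
  - eps p * beta p * (eps l * (l == k)%:R).

Lemma conf_symbol_contract (l k : 'I_n) (X : 'I_n -> R) :
  \sum_p conf_symbol p l k * X p =
  beta l * X k + beta k * X l
  - eps l * (l == k)%:R * \sum_p eps p * beta p * X p.
Proof.
rewrite -(sum_delta k X) -(sum_delta l X) !mulr_sumr -big_split -sumrB /=.
by apply: eq_bigr => p _; rewrite /conf_symbol; ring.
Qed.

(** There is no summation here: each diagonal term alone gives [beta k]. When [l = k], the last term
    removes the doubled contribution. *)
Lemma conf_symbol_trace (l k : 'I_n) : conf_symbol l l k = beta k.
Proof.
rewrite /conf_symbol eqxx; case: eqVneq => [->|_] /=; last by ring.
have -> : eps k * beta k * (eps k * 1) = eps k * eps k * beta k by ring.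
by rewrite epsK; ring.
Qed.

Lemma conf_symbol_beta (j k : 'I_n) :
  \sum_p conf_symbol p j k * beta p =
  2 * (beta j * beta k) - E * (eps j * (j == k)%:R).
Proof.
rewrite conf_symbol_contract.
under eq_bigr do rewrite -mulrA -expr2.
by rewrite betaE; ring.
Qed.

(** This is the quadratic term in the symbols that enters the Ricci tensor. *)
Lemma conf_symbol_square (j k : 'I_n) :
  \sum_l \sum_p conf_symbol p l k * conf_symbol l j p =
  (n%:R + 2) * (beta j * beta k) - 2 * E * (eps j * (j == k)%:R).
Proof.
have inner l : \sum_p conf_symbol p l k * conf_symbol l j p =
    conf_symbol l j k * beta l + beta j * beta k
    - E * ((l == k)%:R * (eps l * (l == j)%:R)).
  rewrite conf_symbol_contract.
  (* The two terms containing [beta l * beta j] cancel because the signs square to one. *)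
  have -> : \sum_p eps p * beta p * conf_symbol l j p = E * (l == j)%:R.
    have -> : E * (l == j)%:R =
        beta j * (\sum_p (p == l)%:R * (eps p * beta p))
        + \sum_i eps i * beta i ^+ 2 * (l == j)%:R
        - \sum_p (p == j)%:R * (eps l * beta l * (eps j * eps p) * beta p).
      by rewrite !sum_delta epsK -mulr_suml betaE; ring.
    rewrite mulr_sumr -big_split -sumrB /=; apply: eq_bigr => p _.
    rewrite /conf_symbol (eq_sym l p) (eq_sym j p).
    by ring.
  rewrite (_ : conf_symbol l j l = beta j).
    by ring.
  rewrite /conf_symbol eqxx (eq_sym l j); case: eqVneq => [->|_] /=; last by ring.
  have -> : eps l * beta l * (eps l * 1) = eps l * eps l * beta l by ring.
  by rewrite epsK; ring.
under eq_bigr => l _ do rewrite inner.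
rewrite sumrB big_split /= sumr_const card_ord conf_symbol_beta -mulr_sumr sum_delta.
rewrite (eq_sym k j); case: (eqVneq j k) => [->|_] /=; by rewrite -mulr_natl; ring.
Qed.

End ConformalSymbol.

Lemma powRB_gt0 (R : realType) (t r s : R) : 0 < t -> t `^ (r - s) = t `^ r / t `^ s.
Proof. by move=> t0; rewrite powRB // (gt_eqF t0) implybT. Qed.

Lemma powR_pred (R : realType) (t s : R) : 0 < t -> t `^ (s - 1) = t `^ s / t.
Proof.
by move=> t0; rewrite powRB_gt0 // powRr1 // ltW.
Qed.

(** Separates the trace of the curvature into four sums to be computed one by one; after an exchange
    of summations the third involves only contracted symbols. *)
Lemma ricci_from_sums (R : realType) (d : nat) (G : 'rV[R]_d -> 'M[R]_d)
    (x : 'rV[R]_d) (j k : 'I_d) (s1 s2 s3 s4 : R) :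
  \sum_l 'D_'e_l (christoffel G l j k) x = s1 ->
  \sum_l 'D_'e_j (christoffel G l l k) x = s2 ->
  \sum_p christoffel G p j k x * (\sum_l christoffel G l l p x) = s3 ->
  \sum_l \sum_p christoffel G p l k x * christoffel G l j p x = s4 ->
  ricci G x j k = s1 - s2 + s3 - s4.
Proof.
move=> <- <- <- <-.
under [X in _ = _ + X - _]eq_bigr do rewrite mulr_sumr.
rewrite exchange_big mxE -sumrB -big_split -sumrB /=; apply: eq_bigr => l _.
by rewrite /riemann sumrB addrA.
Qed.

Section WarpedPower.
Variables (R : realType) (n m : nat) (eps beta : 'rV[R]_n).
Variables (c p0 mu w0 nu : R) (gF : 'rV[R]_m -> 'M[R]_m).
Variables (D : set 'rV[R]_(n + m)) (G : 'rV[R]_(n + m) -> 'M[R]_(n + m)).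

(** The gradient of [u] on the product: zero along the fibre. *)
Let bt : 'rV[R]_(n + m) := row_mx beta 0.
Let u := affine bt c.

Hypothesis epsK : forall i, eps 0 i * eps 0 i = 1.
Hypotheses (p0_neq0 : p0 != 0) (w0_neq0 : w0 != 0).
Hypothesis D_open : open D.
Hypothesis u_gt0 : forall y, D y -> 0 < u y.
Hypothesis gF_sym : forall y, D y -> (gF (rsubmx y))^T = gF (rsubmx y).
Hypothesis gF_unit : forall y, D y -> gF (rsubmx y) \in unitmx.
Hypothesis gF_derivable : forall y, D y -> forall p q s,
  derivable (fun z => gF z p q) (rsubmx y) 'e_s.
Hypothesis GE : forall y, D y ->
  G y = block_mx ((p0 * u y `^ mu) *: diag_mx eps) 0
                 0 ((w0 * u y `^ nu) *: gF (rsubmx y)).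

Let btl i : bt 0 (lshift m i) = beta 0 i. Proof. by rewrite /bt row_mxEl. Qed.
Let btr i : bt 0 (rshift n i) = 0. Proof. by rewrite /bt row_mxEr mxE. Qed.

Lemma near_open (P : 'rV[R]_(n + m) -> Prop) (x : 'rV[R]_(n + m)) :
  D x -> (forall y, D y -> P y) -> \forall y \near x, P y.
Proof. by move=> Dx DP; near=> y; apply: DP; near: y; exact: open_nbhs_nbhs.
Unshelve. all: by end_near. Qed.

(** The metric and its symbols are known explicitly only on [D]; openness allows these formulas to
    be differentiated. *)
Lemma derive_on (f g : 'rV[R]_(n + m) -> R) (x v : 'rV[R]_(n + m)) : D x ->
  (forall y, D y -> f y = g y) -> 'D_v f x = 'D_v g x.
Proof. by move=> Dx fg; apply: near_eq_derive; exact: near_open. Qed.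

Lemma invmx_warped (x : 'rV[R]_(n + m)) : D x ->
  invmx (G x) = block_mx ((p0 * u x `^ mu)^-1 *: diag_mx eps) 0
                  0 ((w0 * u x `^ nu)^-1 *: invmx (gF (rsubmx x))).
Proof.
move=> Dx; have u0 s : u x `^ s != 0 by rewrite gt_eqF // powR_gt0 // u_gt0.
set H := block_mx _ _ _ _.
have GH : G x *m H = 1%:M.
  rewrite GE // /H mulmx_block !mulmx0 !mul0mx !addr0 !add0r scalar_mx_block.
  rewrite -!scalemxAl -!scalemxAr !scalerA !divff ?mulf_neq0 // !scale1r.
  rewrite mulmxV ?gF_unit // mulmx_diag; congr block_mx.
  by apply/matrixP => i j; rewrite !mxE epsK.
by rewrite -[LHS]mulmx1 -GH mulKmx //; have [] := mulmx1_unit GH.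
Qed.

Lemma derive_upow (C s : R) (x : 'rV[R]_(n + m)) i : D x ->
  'D_'e_i (fun y => C * u y `^ s) x = C * s * bt 0 i * u x `^ (s - 1).
Proof. by move=> Dx; have [_ ->] := is_derive_powR_affine C s i (u_gt0 Dx). Qed.

Lemma derivable_upow (C s : R) (x : 'rV[R]_(n + m)) i : D x ->
  derivable (fun y => C * u y `^ s) x 'e_i.
Proof. by move=> Dx; have [] := is_derive_powR_affine C s i (u_gt0 Dx). Qed.

Lemma derive_upow_rsub (C s : R) (g : 'rV[R]_m -> R) (x : 'rV[R]_(n + m)) i :
  D x -> (forall j, derivable g (rsubmx x) 'e_j) ->
  'D_'e_i (fun y => C * u y `^ s * g (rsubmx y)) x =
  C * s * bt 0 i * u x `^ (s - 1) * g (rsubmx x)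
  + C * u x `^ s * 'D_'e_i (g \o rsubmx) x.
Proof.
move=> Dx dg; have dg' : derivable (g \o rsubmx) x 'e_i.
  rewrite -(splitK i); case: (fintype.split i) => j /=.
    exact: derivable_rsub0.
  exact: derivable_rsub (dg j).
rewrite (deriveM (@derivable_upow C s x i Dx) dg') derive_upow // /GRing.scale /=.
by rewrite addrC [X in X + _]mulrC.
Qed.

(** * Christoffel symbols of the warped metric, by blocks *)

Lemma christoffel_base (l : 'I_n) (i j : 'I_(n + m)) (x : 'rV[R]_(n + m)) : D x ->
  christoffel G (lshift m l) i j x =
  (2 * (p0 * u x `^ mu))^-1 * eps 0 l *
  ('D_'e_i (fun y => G y j (lshift m l)) x + 'D_'e_j (fun y => G y i (lshift m l)) x
   - 'D_'e_(lshift m l) (fun y => G y i j) x).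
Proof.
move=> Dx; rewrite /christoffel invmx_warped // big_split_ord /=.
rewrite [X in _ + X]big1 ?addr0; last by move=> s _; rewrite block_mxEur mxE mul0r.
rewrite (bigD1 l) //= big1 ?addr0 => [|s sl].
  by rewrite block_mxEul !mxE eqxx mulr1n (invfM 2) !mulrA.
by rewrite block_mxEul !mxE eq_sym (negbTE sl) mulr0n mulr0 mul0r.
Qed.

Lemma christoffel_fiber (r : 'I_m) (i j : 'I_(n + m)) (x : 'rV[R]_(n + m)) : D x ->
  christoffel G (rshift n r) i j x =
  (2 * (w0 * u x `^ nu))^-1 * \sum_s invmx (gF (rsubmx x)) r s *
  ('D_'e_i (fun y => G y j (rshift n s)) x + 'D_'e_j (fun y => G y i (rshift n s)) x
   - 'D_'e_(rshift n s) (fun y => G y i j) x).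
Proof.
move=> Dx; rewrite /christoffel invmx_warped // big_split_ord /=.
rewrite [X in X + _]big1 ?add0r; last by move=> s _; rewrite block_mxEdl mxE mul0r.
rewrite (invfM 2) -mulrA; congr (_ * _); rewrite mulr_sumr; apply: eq_bigr => s _.
by rewrite block_mxEdr !mxE mulrA.
Qed.

Lemma derive_G_ll (i j : 'I_n) s (x : 'rV[R]_(n + m)) : D x ->
  'D_'e_s (fun y => G y (lshift m i) (lshift m j)) x =
  p0 * mu * bt 0 s * (u x `^ mu / u x) * (eps 0 i * (i == j)%:R).
Proof.
move=> Dx; rewrite (derive_on _ Dx (g := fun y => p0 * (eps 0 i * (i == j)%:R) * u y `^ mu)).
  by rewrite derive_upow // powR_pred ?u_gt0 //; ring.
by move=> y Dy; rewrite GE // block_mxEul !mxE mulr_natr; ring.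
Qed.

Lemma derive_G_lr (i : 'I_n) (p : 'I_m) s (x : 'rV[R]_(n + m)) : D x ->
  'D_'e_s (fun y => G y (lshift m i) (rshift n p)) x = 0.
Proof.
move=> Dx; rewrite (derive_on _ Dx (g := cst 0)) ?derive_cst //.
by move=> y Dy; rewrite GE // block_mxEur mxE.
Qed.

Lemma derive_G_rl (i : 'I_n) (p : 'I_m) s (x : 'rV[R]_(n + m)) : D x ->
  'D_'e_s (fun y => G y (rshift n p) (lshift m i)) x = 0.
Proof.
move=> Dx; rewrite (derive_on _ Dx (g := cst 0)) ?derive_cst //.
by move=> y Dy; rewrite GE // block_mxEdl mxE.
Qed.

Lemma derive_G_rr (p q : 'I_m) s (x : 'rV[R]_(n + m)) : D x ->
  'D_'e_s (fun y => G y (rshift n p) (rshift n q)) x =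
  w0 * nu * bt 0 s * (u x `^ nu / u x) * gF (rsubmx x) p q
  + w0 * u x `^ nu * 'D_'e_s ((fun z => gF z p q) \o rsubmx) x.
Proof.
move=> Dx; rewrite (derive_on _ Dx (g := fun y => w0 * u y `^ nu * gF (rsubmx y) p q)).
  rewrite (derive_upow_rsub _ _ _ Dx (g := fun z => gF z p q)) ?powR_pred ?u_gt0 //.
  by move=> j; exact: gF_derivable.
by move=> y Dy; rewrite GE // block_mxEdr !mxE.
Qed.

(** [E] is the pseudo-Euclidean square of the gradient of [u]. Writing the base metric as exp(2w)
    times the flat one, w has gradient [kp * beta / u]; the logarithm of the warping function has
    gradient [th * beta / u]. The symbols with upper index in the base and both lower ones in the
    fibre carry the constant [ta] and the power u^z. *)
Let E := \sum_i eps 0 i * beta 0 i ^+ 2.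
Let kp := mu / 2.
Let th := nu / 2.
Let ta := - (th * w0 / p0).
Let z := nu - mu - 1.
Let cs := conf_symbol (fun i => eps 0 i) (fun i => beta 0 i).

Lemma christoffel_lll (l i j : 'I_n) (x : 'rV[R]_(n + m)) : D x ->
  christoffel G (lshift m l) (lshift m i) (lshift m j) x =
  kp * cs l i j * u x `^ (-1).
Proof.
move=> Dx; rewrite christoffel_base // !derive_G_ll // !btl.
have u0 := u_gt0 Dx; rewrite powR_inv1 ?ltW //.
have um : u x `^ mu != 0 by rewrite gt_eqF // powR_gt0.
rewrite /kp /cs /conf_symbol (eq_sym j l) (eq_sym i l).
(* The relation [epsK] is invisible to [field], so each Kronecker delta is first traded for a
   product with [eps 0 l]. *)
have e (k : 'I_n) : eps 0 l * (eps 0 k * (l == k)%:R) = (l == k)%:R.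
  by case: eqVneq => [->|_]; rewrite ?mulr0 // mulr1 epsK.
set Ej := eps 0 j * _; set Ei := eps 0 i * (l == i)%:R; set Eij := eps 0 i * _.
have ej := e j; have ei := e i; rewrite -ej -ei -/Ej -/Ei.
by field; rewrite um p0_neq0 gt_eqF.
Qed.

Lemma christoffel_llr (l i : 'I_n) (q : 'I_m) (x : 'rV[R]_(n + m)) : D x ->
  christoffel G (lshift m l) (lshift m i) (rshift n q) x = 0.
Proof.
move=> Dx; rewrite christoffel_base // derive_G_lr // derive_G_rl // derive_G_ll //.
by rewrite btr; ring.
Qed.

Lemma christoffel_lrl (l i : 'I_n) (q : 'I_m) (x : 'rV[R]_(n + m)) : D x ->
  christoffel G (lshift m l) (rshift n q) (lshift m i) x = 0.
Proof.
move=> Dx; rewrite christoffel_base // !derive_G_rl // derive_G_ll //.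
by rewrite btr; ring.
Qed.

(** In invariant terms this is minus the warping function times its gradient times [gF]: the
    extrinsic curvature of the fibres. *)
Lemma christoffel_lrr (l : 'I_n) (p q : 'I_m) (x : 'rV[R]_(n + m)) : D x ->
  christoffel G (lshift m l) (rshift n p) (rshift n q) x =
  ta * (eps 0 l * beta 0 l) * u x `^ z * gF (rsubmx x) p q.
Proof.
move=> Dx; rewrite christoffel_base // !derive_G_rl // derive_G_rr // btl.
rewrite derive_rsub0 mulr0 !addr0 sub0r.
have u0 := u_gt0 Dx; rewrite /z powR_pred // powRB_gt0 //.
have um : u x `^ mu != 0 by rewrite gt_eqF // powR_gt0.
by rewrite /ta /th; field; rewrite um p0_neq0 gt_eqF.
Qed.

Lemma christoffel_rll (r : 'I_m) (i j : 'I_n) (x : 'rV[R]_(n + m)) : D x ->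
  christoffel G (rshift n r) (lshift m i) (lshift m j) x = 0.
Proof.
move=> Dx; rewrite christoffel_fiber // big1 ?mulr0 // => s _.
by rewrite !derive_G_lr // derive_G_ll // btr; ring.
Qed.

Lemma invmx_gF (r q : 'I_m) (x : 'rV[R]_(n + m)) : D x ->
  \sum_s invmx (gF (rsubmx x)) r s * gF (rsubmx x) q s = (r == q)%:R.
Proof.
move=> Dx; have := mulVmx (gF_unit Dx) => /matrixP /(_ r q); rewrite !mxE => <-.
by apply: eq_bigr => s _; rewrite -[in RHS](gF_sym Dx) [in RHS]mxE gF_sym.
Qed.

Lemma christoffel_rlr (r q : 'I_m) (i : 'I_n) (x : 'rV[R]_(n + m)) : D x ->
  christoffel G (rshift n r) (lshift m i) (rshift n q) x =
  th * beta 0 i * (r == q)%:R * u x `^ (-1).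
Proof.
move=> Dx; rewrite christoffel_fiber //.
have u0 := u_gt0 Dx; rewrite powR_inv1 ?ltW //.
have un : u x `^ nu != 0 by rewrite gt_eqF // powR_gt0.
rewrite -(invmx_gF _ _ Dx) (_ : \sum_s _ = w0 * nu * beta 0 i * (u x `^ nu / u x)
  * \sum_s invmx (gF (rsubmx x)) r s * gF (rsubmx x) q s).
  by rewrite /th; field; rewrite un w0_neq0 gt_eqF.
rewrite mulr_sumr; apply: eq_bigr => s _.
by rewrite derive_G_rr // !derive_G_lr // btl derive_rsub0; ring.
Qed.

Lemma christoffel_rrl (r q : 'I_m) (i : 'I_n) (x : 'rV[R]_(n + m)) : D x ->
  christoffel G (rshift n r) (rshift n q) (lshift m i) x =
  th * beta 0 i * (r == q)%:R * u x `^ (-1).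
Proof.
move=> Dx; rewrite -christoffel_rlr // !christoffel_fiber //; congr (_ * _).
apply: eq_bigr => s _; rewrite !derive_G_lr // !derive_G_rl // !derive_G_rr //.
by ring.
Qed.

(** The warping factor is constant along the fibre, and Christoffel symbols do not change under
    constant rescaling. *)
Lemma christoffel_rrr (r p q : 'I_m) (x : 'rV[R]_(n + m)) : D x ->
  christoffel G (rshift n r) (rshift n p) (rshift n q) x =
  christoffel gF r p q (rsubmx x).
Proof.
move=> Dx; rewrite christoffel_fiber // /christoffel (invfM 2) -mulrA; congr (_ * _).
rewrite mulr_sumr; apply: eq_bigr => s _.
rewrite !derive_G_rr // !btr !derive_rsub.
have u0 := u_gt0 Dx.
have un : u x `^ nu != 0 by rewrite gt_eqF // powR_gt0.
by field; rewrite un w0_neq0 gt_eqF.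
Qed.

(** Symmetry of [gF] is given at points [rsubmx y] with [D y], so the derivatives are lifted to the
    total space, where [D] is open. *)
Lemma christoffel_gFC (r p q : 'I_m) (x : 'rV[R]_(n + m)) : D x ->
  christoffel gF r p q (rsubmx x) = christoffel gF r q p (rsubmx x).
Proof.
move=> Dx; rewrite /christoffel; congr (_ * _); apply: eq_bigr => s _.
have -> : 'D_'e_s (fun y => gF y p q) (rsubmx x) = 'D_'e_s (fun y => gF y q p) (rsubmx x).
  rewrite -!derive_rsub; apply: derive_on => // y Dy /=.
  by rewrite -{1}(gF_sym Dy) mxE.
by congr (_ * (_ - _)); rewrite addrC.
Qed.

(* Otherwise unification of sums of Christoffel symbols unfolds them and does not
   terminate in reasonable time. *)
#[local] Opaque christoffel.

(** Contracted symbols are the gradient of log sqrt |det G|, and det G contains u to the power n mu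
    + m nu. *)
Lemma trace_christoffel_l (k : 'I_n) (x : 'rV[R]_(n + m)) : D x ->
  \sum_l christoffel G l l (lshift m k) x =
  (n%:R * kp + m%:R * th) * beta 0 k / u x.
Proof.
move=> Dx; have u0 := u_gt0 Dx; rewrite big_split_ord /=.
under eq_bigr => l _ do
  rewrite christoffel_lll // /cs conf_symbol_trace // powR_inv1 ?ltW //.
under [X in _ + X]eq_bigr => r _ do
  rewrite christoffel_rrl // eqxx mulr1 powR_inv1 ?ltW //.
by rewrite !sumr_const !card_ord -(mulr_natl _ n) -(mulr_natl _ m); ring.
Qed.

Lemma trace_christoffel_r (q : 'I_m) (x : 'rV[R]_(n + m)) : D x ->
  \sum_l christoffel G l l (rshift n q) x =
  \sum_l christoffel gF l l q (rsubmx x).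
Proof.
move=> Dx; rewrite big_split_ord /= big1 ?add0r => [|l _].
  by apply: eq_bigr => r _; rewrite christoffel_rrr.
by rewrite christoffel_llr.
Qed.

Lemma derive_upow_inv (C : R) (x : 'rV[R]_(n + m)) i : D x ->
  'D_'e_i (fun y => C * u y `^ (-1)) x = - (C * bt 0 i / u x ^+ 2).
Proof.
move=> Dx; have u0 := u_gt0 Dx.
rewrite derive_upow // powR_pred // powR_inv1 ?ltW //.
by field; rewrite gt_eqF.
Qed.

Lemma derive_zero_on (f : 'rV[R]_(n + m) -> R) (x v : 'rV[R]_(n + m)) : D x ->
  (forall y, D y -> f y = 0) -> 'D_v f x = 0.
Proof. by move=> Dx f0; rewrite (derive_on _ Dx f0) derive_cst. Qed.

(* The Ricci tensor by blocks *)
#[local] Opaque derive.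

Lemma ricci_warped_ll (j k : 'I_n) (x : 'rV[R]_(n + m)) : D x ->
  let b := beta 0 j * beta 0 k in
  let d := E * (eps 0 j * (j == k)%:R) in
  let T := n%:R * kp + m%:R * th in
  ricci G x (lshift m j) (lshift m k) =
  (T * b - kp * (1 - T) * (2 * b - d) - kp ^+ 2 * ((n%:R + 2) * b - 2 * d)
   - m%:R * th ^+ 2 * b) / u x ^+ 2.
Proof.
move=> Dx b d T; have u0 := u_gt0 Dx; have ui : u x `^ (-1) = (u x)^-1.
  by rewrite powR_inv1 ?ltW.
have S1 : \sum_l 'D_'e_l (christoffel G l (lshift m j) (lshift m k)) x =
    - (kp * (2 * b - d) / u x ^+ 2).
  rewrite big_split_ord /= [X in _ + X]big1 ?addr0 => [|r _]; last first.
    by apply: derive_zero_on => // y Dy; rewrite christoffel_rll.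
  rewrite -(conf_symbol_beta (erefl E)) mulr_sumr mulr_suml -sumrN.
  apply: eq_bigr => l _.
  rewrite (derive_on _ Dx (christoffel_lll l j k)) derive_upow_inv // btl.
  by rewrite /cs; ring.
have S2 : \sum_l 'D_'e_(lshift m j) (christoffel G l l (lshift m k)) x =
    - (T * b / u x ^+ 2).
  rewrite big_split_ord /=.
  under eq_bigr => l _ do rewrite (derive_on _ Dx (christoffel_lll l l k))
    derive_upow_inv // /cs conf_symbol_trace // btl.
  under [X in _ + X]eq_bigr => r _ do rewrite (derive_on _ Dx (christoffel_rrl r r k))
    derive_upow_inv // eqxx mulr1 btl.
  by rewrite !sumr_const !card_ord -(mulr_natl _ n) -(mulr_natl _ m) /T /b; ring.
have S3 : \sum_p christoffel G p (lshift m j) (lshift m k) x *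
      (\sum_l christoffel G l l p x) = kp * T * (2 * b - d) / u x ^+ 2.
  rewrite big_split_ord /= [X in _ + X]big1 ?addr0 => [|r _]; last first.
    by rewrite christoffel_rll // mul0r.
  rewrite -(conf_symbol_beta (erefl E)) mulr_sumr mulr_suml.
  apply: eq_bigr => l _.
  rewrite christoffel_lll // trace_christoffel_l // ui /cs /T.
  by field; rewrite gt_eqF.
have S4l : \sum_(l < n) \sum_p christoffel G p (lshift m l) (lshift m k) x *
    christoffel G (lshift m l) (lshift m j) p x =
    kp ^+ 2 * ((n%:R + 2) * b - 2 * d) / u x ^+ 2.
  have sq : \sum_l \sum_p cs p l k * cs l j p = (n%:R + 2) * b - 2 * d.
    by rewrite /d mulrA; exact: conf_symbol_square.
  rewrite -sq mulr_sumr mulr_suml.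
  apply: eq_bigr => l _; rewrite big_split_ord /= [X in _ + X]big1 ?addr0 => [|r _].
    rewrite mulr_sumr mulr_suml; apply: eq_bigr => p _.
    by rewrite !christoffel_lll // ui /cs; field; rewrite gt_eqF.
  by rewrite christoffel_rll // mul0r.
(* Each of the [m] fibre directions contributes one copy of the squared logarithmic gradient of the
   warping function. *)
have S4r : \sum_(r < m) \sum_p christoffel G p (rshift n r) (lshift m k) x *
    christoffel G (rshift n r) (lshift m j) p x =
    m%:R * (th ^+ 2 * b / u x ^+ 2).
  rewrite mulr_natl -[in RHS](card_ord m) -sumr_const.
  apply: eq_bigr => r _; rewrite big_split_ord /= big1 ?add0r => [|p _]; last first.
    by rewrite christoffel_lrl // mul0r.
  rewrite -(sum_delta r (fun=> th ^+ 2 * b / u x ^+ 2)); apply: eq_bigr => p _.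
  rewrite christoffel_rrl // christoffel_rlr // ui (eq_sym r p) /b.
  by case: eqVneq => _ /=; field; rewrite gt_eqF.
by rewrite (ricci_from_sums S1 S2 S3 (sum_ord_split S4l S4r)) /T; field; rewrite gt_eqF.
Qed.

(** Only the third sum and the fibre half of the fourth survive; both equal the same multiple of the
    fibre trace [Tq], and they cancel. *)
Lemma ricci_warped_lr (j : 'I_n) (q : 'I_m) (x : 'rV[R]_(n + m)) : D x ->
  ricci G x (lshift m j) (rshift n q) = 0.
Proof.
move=> Dx; set Tq := \sum_s christoffel gF s s q (rsubmx x).
have S1 : \sum_l 'D_'e_l (christoffel G l (lshift m j) (rshift n q)) x = 0.
  apply: big1 => l _; rewrite -(splitK l); case: (fintype.split l) => r /=.
    by apply: derive_zero_on => // y Dy; rewrite christoffel_llr.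
  by rewrite (derive_on _ Dx (christoffel_rlr r q j)) derive_upow_inv // btr; ring.
have S2 : \sum_l 'D_'e_(lshift m j) (christoffel G l l (rshift n q)) x = 0.
  apply: big1 => l _; rewrite -(splitK l); case: (fintype.split l) => r /=.
    by apply: derive_zero_on => // y Dy; rewrite christoffel_llr.
  rewrite (derive_on _ Dx (christoffel_rrr r r q)).
  exact: (derive_rsub0 (christoffel gF r r q)).
have S3 : \sum_p christoffel G p (lshift m j) (rshift n q) x *
    (\sum_l christoffel G l l p x) = th * beta 0 j * u x `^ (-1) * Tq.
  rewrite big_split_ord /= big1 ?add0r => [|p _]; last first.
    by rewrite christoffel_llr // mul0r.
  rewrite -(sum_delta q (fun p => _ * \sum_s christoffel gF s s p (rsubmx x))).
  apply: eq_bigr => p _; rewrite christoffel_rlr // trace_christoffel_r //.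
  by ring.
have S4l : \sum_(l < n) \sum_p christoffel G p (lshift m l) (rshift n q) x *
    christoffel G (lshift m l) (lshift m j) p x = 0.
  apply: big1 => l _; apply: big1 => p _.
  rewrite -(splitK p); case: (fintype.split p) => r /=.
    by rewrite [X in X * _]christoffel_llr // mul0r.
  by rewrite [X in _ * X]christoffel_llr // mulr0.
have S4r : \sum_(r < m) \sum_p christoffel G p (rshift n r) (rshift n q) x *
    christoffel G (rshift n r) (lshift m j) p x = th * beta 0 j * u x `^ (-1) * Tq.
  rewrite mulr_sumr; apply: eq_bigr => r _.
  rewrite big_split_ord /= big1 ?add0r => [|p _]; last first.
    by rewrite [X in _ * X]christoffel_rll // mulr0.
  rewrite -(sum_delta r (fun p => _ * christoffel gF p r q (rsubmx x))).
  apply: eq_bigr => p _; rewrite [X in X * _]christoffel_rrr // christoffel_rlr //.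
  by rewrite (eq_sym r p); ring.
by rewrite (ricci_from_sums S1 S2 S3 (sum_ord_split S4l S4r)); ring.
Qed.

(** The cancellation of [ricci_warped_lr] again, but the fibre symbols arise with their lower
    indices swapped, whence [christoffel_gFC]. *)
Lemma ricci_warped_rl (k : 'I_n) (q : 'I_m) (x : 'rV[R]_(n + m)) : D x ->
  ricci G x (rshift n q) (lshift m k) = 0.
Proof.
move=> Dx; set Tq := \sum_s christoffel gF s s q (rsubmx x).
have S1 : \sum_l 'D_'e_l (christoffel G l (rshift n q) (lshift m k)) x = 0.
  apply: big1 => l _; rewrite -(splitK l); case: (fintype.split l) => r /=.
    by apply: derive_zero_on => // y Dy; rewrite christoffel_lrl.
  by rewrite (derive_on _ Dx (christoffel_rrl r q k)) derive_upow_inv // btr; ring.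
have S2 : \sum_l 'D_'e_(rshift n q) (christoffel G l l (lshift m k)) x = 0.
  apply: big1 => l _; rewrite -(splitK l); case: (fintype.split l) => r /=.
    by rewrite (derive_on _ Dx (christoffel_lll r r k)) derive_upow_inv // btr; ring.
  by rewrite (derive_on _ Dx (christoffel_rrl r r k)) derive_upow_inv // btr; ring.
have S3 : \sum_p christoffel G p (rshift n q) (lshift m k) x *
    (\sum_l christoffel G l l p x) = th * beta 0 k * u x `^ (-1) * Tq.
  rewrite big_split_ord /= big1 ?add0r => [|p _]; last first.
    by rewrite christoffel_lrl // mul0r.
  rewrite -(sum_delta q (fun p => _ * \sum_s christoffel gF s s p (rsubmx x))).
  apply: eq_bigr => p _; rewrite christoffel_rrl // trace_christoffel_r //.
  by ring.
have S4l : \sum_(l < n) \sum_p christoffel G p (lshift m l) (lshift m k) x *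
    christoffel G (lshift m l) (rshift n q) p x = 0.
  apply: big1 => l _; apply: big1 => p _.
  rewrite -(splitK p); case: (fintype.split p) => r /=.
    by rewrite [X in _ * X]christoffel_lrl // mulr0.
  by rewrite [X in X * _]christoffel_rll // mul0r.
have S4r : \sum_(r < m) \sum_p christoffel G p (rshift n r) (lshift m k) x *
    christoffel G (rshift n r) (rshift n q) p x = th * beta 0 k * u x `^ (-1) * Tq.
  rewrite mulr_sumr; apply: eq_bigr => r _.
  rewrite big_split_ord /= big1 ?add0r => [|p _]; last first.
    by rewrite [X in X * _]christoffel_lrl // mul0r.
  rewrite -(sum_delta r (fun p => _ * christoffel gF r p q (rsubmx x))).
  apply: eq_bigr => p _; rewrite [X in X * _]christoffel_rrl // christoffel_rrr //.
  by rewrite christoffel_gFC //; ring.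
by rewrite (ricci_from_sums S1 S2 S3 (sum_ord_split S4l S4r)); ring.
Qed.

Lemma ricci_warped_rr (p q : 'I_m) (x : 'rV[R]_(n + m)) : D x ->
  ricci G x (rshift n p) (rshift n q) =
  ricci gF (rsubmx x) p q
  + ta * E * (n%:R * kp + (m%:R - 2) * th + z) * (u x `^ z / u x) * gF (rsubmx x) p q.
Proof.
move=> Dx; have u0 := u_gt0 Dx; have ui : u x `^ (-1) = (u x)^-1.
  by rewrite powR_inv1 ?ltW.
have S1l : \sum_(l < n) 'D_'e_(lshift m l) (christoffel G (lshift m l) (rshift n p) (rshift n q)) x
    = ta * E * z * (u x `^ z / u x) * gF (rsubmx x) p q.
  rewrite /E mulr_sumr !mulr_suml; apply: eq_bigr => l _.
  rewrite (derive_on _ Dx (christoffel_lrr l p q)).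
  rewrite (derive_upow_rsub _ _ _ Dx (g := fun y => gF y p q)); last first.
    by move=> s; exact: gF_derivable.
  by rewrite derive_rsub0 powR_pred // btl /=; ring.
have S1r : \sum_(r < m) 'D_'e_(rshift n r) (christoffel G (rshift n r) (rshift n p) (rshift n q)) x
    = \sum_r 'D_'e_r (christoffel gF r p q) (rsubmx x).
  apply: eq_bigr => r _; rewrite (derive_on _ Dx (christoffel_rrr r p q)).
  exact: (derive_rsub (christoffel gF r p q)).
have S2 : \sum_l 'D_'e_(rshift n p) (christoffel G l l (rshift n q)) x =
    \sum_r 'D_'e_p (christoffel gF r r q) (rsubmx x).
  rewrite big_split_ord /= big1 ?add0r => [|l _]; last first.
    by apply: derive_zero_on => // y Dy; rewrite christoffel_llr.
  apply: eq_bigr => r _; rewrite (derive_on _ Dx (christoffel_rrr r r q)).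
  exact: (derive_rsub (christoffel gF r r q)).
have S3l : \sum_(l < n) christoffel G (lshift m l) (rshift n p) (rshift n q) x *
    (\sum_s christoffel G s s (lshift m l) x) =
    ta * E * (n%:R * kp + m%:R * th) * (u x `^ z / u x) * gF (rsubmx x) p q.
  rewrite /E mulr_sumr !mulr_suml; apply: eq_bigr => l _.
  by rewrite christoffel_lrr // trace_christoffel_l //; ring.
have S3r : \sum_(r < m) christoffel G (rshift n r) (rshift n p) (rshift n q) x *
    (\sum_s christoffel G s s (rshift n r) x) =
    \sum_r christoffel gF r p q (rsubmx x) * \sum_s christoffel gF s s r (rsubmx x).
  by apply: eq_bigr => r _; rewrite christoffel_rrr // trace_christoffel_r.
have S4l : \sum_(l < n) \sum_s christoffel G s (lshift m l) (rshift n q) x *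
    christoffel G (lshift m l) (rshift n p) s x =
    ta * th * E * (u x `^ z / u x) * gF (rsubmx x) p q.
  rewrite /E mulr_sumr !mulr_suml; apply: eq_bigr => l _.
  rewrite big_split_ord /= big1 ?add0r => [|s _]; last first.
    by rewrite [X in X * _]christoffel_llr // mul0r.
  rewrite -(sum_delta q (fun s => _ * gF (rsubmx x) p s)); apply: eq_bigr => s _.
  by rewrite christoffel_rlr // christoffel_lrr // ui; ring.
have S4r : \sum_(r < m) \sum_s christoffel G s (rshift n r) (rshift n q) x *
    christoffel G (rshift n r) (rshift n p) s x =
    ta * th * E * (u x `^ z / u x) * gF (rsubmx x) p q +
    \sum_r \sum_s christoffel gF s r q (rsubmx x) * christoffel gF r p s (rsubmx x).
  rewrite -(sum_delta p (fun r => _ * gF (rsubmx x) r q)) -big_split /=.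
  apply: eq_bigr => r _; apply: sum_ord_split.
    rewrite /E mulr_sumr !mulr_suml mulr_sumr; apply: eq_bigr => s _.
    by rewrite christoffel_lrr // christoffel_rrl // ui; ring.
  by apply: eq_bigr => s _; rewrite !christoffel_rrr.
rewrite (ricci_from_sums (sum_ord_split S1l S1r) S2 (sum_ord_split S3l S3r)
  (sum_ord_split S4l S4r)).
rewrite (@ricci_from_sums _ _ gF (rsubmx x) p q _ _ _ _ erefl erefl erefl erefl).
(* The [s] terms reassemble [ricci gF]. The term [a4] occurs twice, once in each half of the fourth
   sum, which turns [m%:R] into [m%:R - 2] in front of [th]. *)
have regroup (a1 a3 a4 s1 s2 s3 s4 t : R) : t = a1 + a3 - 2 * a4 ->
    a1 + s1 - s2 + (a3 + s3) - (a4 + (a4 + s4)) = s1 - s2 + s3 - s4 + t.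
  by move=> ->; ring.
by apply: regroup; ring.
Qed.

(** * The Hessian of a power of [u], and the quasi-Einstein equation *)

Section Hessian.
Variables (h0 eta : R) (H : 'rV[R]_(n + m) -> R).
Hypothesis HE : forall y, D y -> H y = h0 * u y `^ eta.

Lemma derive_H i (x : 'rV[R]_(n + m)) : D x ->
  'D_'e_i H x = h0 * eta * bt 0 i * u x `^ (eta - 1).
Proof. by move=> Dx; rewrite (derive_on _ Dx HE) derive_upow. Qed.

(** As [H] depends on the base alone, only symbols with upper index in the base contribute. *)
Lemma hessian_warped (i j : 'I_(n + m)) (x : 'rV[R]_(n + m)) : D x ->
  hessian G H x i j =
  h0 * u x `^ eta * (eta * (eta - 1) * (bt 0 i * bt 0 j) / u x ^+ 2
  - eta / u x * \sum_l christoffel G (lshift m l) i j x * beta 0 l).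
Proof.
move=> Dx; have u0 := u_gt0 Dx.
rewrite mxE (derive_on _ Dx (derive_H j)) derive_upow // big_split_ord /=.
rewrite [X in _ - (_ + X)]big1 ?addr0 => [|r _]; last by rewrite derive_H // btr; ring.
rewrite (_ : \sum_l _ = h0 * u x `^ eta * (eta / u x) *
    \sum_l christoffel G (lshift m l) i j x * beta 0 l); last first.
  rewrite mulr_sumr; apply: eq_bigr => l _.
  by rewrite derive_H // btl powR_pred //; ring.
by rewrite !powR_pred //; field; rewrite gt_eqF.
Qed.

Lemma hessian_warped_ll (i j : 'I_n) (x : 'rV[R]_(n + m)) : D x ->
  let b := beta 0 i * beta 0 j in
  let d := E * (eps 0 i * (i == j)%:R) in
  hessian G H x (lshift m i) (lshift m j) =
  H x * (eta * ((eta - 1) * b - kp * (2 * b - d)) / u x ^+ 2).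
Proof.
move=> Dx b d; have u0 := u_gt0 Dx.
rewrite hessian_warped // -HE // !btl.
rewrite (_ : \sum_l _ = kp / u x * (2 * b - d)).
  by rewrite /b; field; rewrite gt_eqF.
rewrite -(conf_symbol_beta (erefl E)) mulr_sumr; apply: eq_bigr => l _.
by rewrite christoffel_lll // powR_inv1 ?ltW // /cs; ring.
Qed.

Lemma hessian_warped_lr (i : 'I_n) (q : 'I_m) (x : 'rV[R]_(n + m)) : D x ->
  hessian G H x (lshift m i) (rshift n q) = 0.
Proof.
move=> Dx; rewrite hessian_warped // btr big1 => [|l _]; last first.
  by rewrite christoffel_llr // mul0r.
by ring.
Qed.

Lemma hessian_warped_rl (i : 'I_n) (q : 'I_m) (x : 'rV[R]_(n + m)) : D x ->
  hessian G H x (rshift n q) (lshift m i) = 0.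
Proof.
move=> Dx; rewrite hessian_warped // btr big1 => [|l _]; last first.
  by rewrite christoffel_lrl // mul0r.
by ring.
Qed.

Lemma hessian_warped_rr (p q : 'I_m) (x : 'rV[R]_(n + m)) : D x ->
  hessian G H x (rshift n p) (rshift n q) =
  - (H x * (ta * E * eta * (u x `^ z / u x) * gF (rsubmx x) p q)).
Proof.
move=> Dx; rewrite hessian_warped // -HE // !btr.
rewrite (_ : \sum_l _ = ta * E * u x `^ z * gF (rsubmx x) p q); first by ring.
rewrite /E mulr_sumr !mulr_suml; apply: eq_bigr => l _.
by rewrite christoffel_lrr //; ring.
Qed.

(* The first equation is the vanishing of the coefficient of [beta_i beta_j]; the
   second covers both the coefficient of [eps_i delta_ij] and the fibre part. *)
Lemma quasi_einstein_warped_power (x : 'rV[R]_(n + m)) : D x -> h0 != 0 ->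
  ricci gF (rsubmx x) = 0 ->
  let T := n%:R * kp + m%:R * th in
  T * (1 + 2 * kp) - 2 * kp - kp ^+ 2 * (n%:R + 2) - m%:R * th ^+ 2
    - eta * (eta - 1 - 2 * kp) = 0 ->
  T + eta = 1 + 2 * kp ->
  ricci G x - (1 / H x) *: hessian G H x = 0.
Proof.
move=> Dx h00 flat T e1 e2; have u0 := u_gt0 Dx.
have Hx : H x != 0 by rewrite HE // mulf_neq0 // gt_eqF // powR_gt0.
have cancelH y : 1 / H x * (H x * y) = y by rewrite mulrA divfK // mul1r.
apply/matrixP => i j; rewrite [LHS]mxE [X in _ + X]mxE [X in _ - X]mxE [RHS]mxE.
rewrite -(splitK i) -(splitK j).
case: (fintype.split i) => {}i /=; case: (fintype.split j) => {}j /=.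
- rewrite ricci_warped_ll // hessian_warped_ll //.
  rewrite cancelH -mulrBl.
  set b := beta 0 i * beta 0 j; set d := E * _.
  rewrite (_ : _ - _ = b * (T * (1 + 2 * kp) - 2 * kp - kp ^+ 2 * (n%:R + 2)
    - m%:R * th ^+ 2 - eta * (eta - 1 - 2 * kp)) + kp * d * (1 + 2 * kp - (T + eta)));
    last by rewrite /T; ring.
  by rewrite e1 e2 subrr !mulr0 addr0 mul0r.
- by rewrite ricci_warped_lr // hessian_warped_lr // mulr0 subrr.
- by rewrite ricci_warped_rl // hessian_warped_rl // mulr0 subrr.
- rewrite ricci_warped_rr // hessian_warped_rr // flat mxE add0r.
  rewrite mulrN opprK cancelH.
  set g := gF _ _ _; set v := _ / u x.
  (* Here [2 * th] cancels the [- 2 * th] of the fibre Ricci block, leaving the expression that [e2]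
     kills. *)
  have zE : z = 2 * th - 2 * kp - 1 by rewrite /z /th /kp; field.
  rewrite (_ : _ + _ = ta * E * v * g * (T + eta - (1 + 2 * kp))); last first.
    by rewrite zE /T; ring.
  by rewrite e2 subrr mulr0.
Qed.

End Hessian.

End WarpedPower.

(** * Warped products of semi-Riemannian manifolds *)

Lemma Ck_on_subset (R : realType) (d k : nat) (D' D : set 'rV[R]_d)
    (f : 'rV[R]_d -> R) : D' `<=` D -> Ck_on k D f -> Ck_on k D' f.
Proof.
move=> DD; elim: k f => [|k IHk] f [fc fk]; first by split=> // x /DD; exact: fc.
split=> [x /DD|i]; first exact: fc.
by have [df Cf] := fk i; split=> [x /DD|]; [exact: df|exact: IHk].
Qed.

Lemma coord_affine (R : realType) (d : nat) (q : 'I_d) :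
  (fun y : 'rV[R]_d => y 0 q) = affine 'e_q 0.
Proof.
apply/funext => y; rewrite /affine addr0 (bigD1 q) //= big1 => [|i iq].
  by rewrite mxE !eqxx mul1r addr0.
by rewrite mxE (negbTE iq) andbF mul0r.
Qed.

(** Dividing an orthonormal basis by the square root of [a] makes it orthonormal for the rescaled
    form. *)
Lemma has_index_scale (R : realType) (d nu : nat) (a : R) (S : 'M[R]_d) :
  0 < a -> has_index S nu -> has_index (a *: S) nu.
Proof.
move=> a0 [P [T [Pu cT PS]]]; exists ((Num.sqrt a)^-1 *: P), T.
have sa : Num.sqrt a != 0 by rewrite gt_eqF // sqrtr_gt0.
split=> //; first by rewrite unitmxZ // unitfE invr_eq0.
have -> : ((Num.sqrt a)^-1 *: P)^T = (Num.sqrt a)^-1 *: P^T by rewrite linearZ.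
rewrite -!(scalemxAl, scalemxAr) !scalerA PS -[RHS]scale1r; congr (_ *: _).
by have := sqr_sqrtr (ltW a0); move: (Num.sqrt a) sa => t t0 <-; field.
Qed.

(** Orthonormal bases of the two blocks are juxtaposed, and their timelike index sets land in
    disjoint ranges. *)
Lemma has_index_block (R : realType) (n m nu nu' : nat) (S : 'M[R]_n) (S' : 'M[R]_m) :
  has_index S nu -> has_index S' nu' -> has_index (block_mx S 0 0 S') (nu + nu').
Proof.
move=> [P [T [Pu cT PS]]] [P' [T' [Pu' cT' PS']]].
exists (block_mx P 0 0 P'), ((@lshift n m @: T) :|: (@rshift n m @: T'))%SET; split.
- by rewrite unitmxE det_ublock unitrM -!unitmxE Pu Pu'.
- rewrite cardsU !card_imset; try exact: lshift_inj; try exact: rshift_inj.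
  rewrite cT cT' (_ : (_ :&: _)%SET = finset.set0) ?cards0 ?subn0 //.
  apply/setP => i; rewrite !inE; apply/negbTE/negP => /andP[/imsetP[j _ ->]].
  by move=> /imsetP[j' _ /eqP]; rewrite eq_lrshift.
- rewrite tr_block_mx !trmx0 !mulmx_block !mulmx0 !mul0mx !addr0 !add0r PS PS' !mul0mx.
  rewrite -diag_mx_row; congr diag_mx; apply/rowP => i.
  rewrite -(splitK i); case: (fintype.split i) => j /=.
    rewrite row_mxEl !mxE !inE mem_imset; last exact: lshift_inj.
    rewrite (_ : (lshift m j \in [set rshift n x | x in T']%SET) = false) ?orbF //.
    by apply/negbTE/negP => /imsetP[j' _ /eqP]; rewrite eq_lrshift.
  rewrite row_mxEr !mxE !inE mem_imset; last exact: rshift_inj.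
  rewrite (_ : (rshift n j \in [set lshift m x | x in T]%SET) = false) //.
  by apply/negbTE/negP => /imsetP[j' _ /eqP]; rewrite eq_rlshift.
Qed.

Lemma has_index_diag (R : realType) (d : nat) (eps : 'rV[R]_d) :
  (forall i, eps 0 i = 1 \/ eps 0 i = -1) ->
  has_index (diag_mx eps) #|[set i | eps 0 i == -1]%SET|.
Proof.
move=> epsE; exists 1%:M, [set i | eps 0 i == -1]%SET.
split; rewrite ?unitmx1 // trmx1 mul1mx mulmx1; congr diag_mx.
apply/rowP => i; rewrite mxE inE; have [->|->] := epsE i; last by rewrite eqxx.
by rewrite ifN // gt_eqF // (lt_trans (ltrN10 _)).
Qed.

(** * Atlas and metric tensor over an open base with a single chart *)

Section WarpedProduct.
Variables (R : realType) (n m : nat) (U : set 'rV[R]_n) (gb : 'rV[R]_n -> 'M[R]_n).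
Variables (f : 'rV[R]_n -> R) (F : chart_data R m).
Let W := warped_product (euclidean_domain U gb) f F.

Definition over (U' : set 'rV[R]_n) (V : set 'rV[R]_m) : set 'rV[R]_(n + m) :=
  [set y | U' (lsubmx y) /\ V (rsubmx y)].

Lemma over_open (V : set 'rV[R]_m) : open U -> open V -> open (over U V).
Proof.
move=> oU oV; apply: openI.
  by apply: open_comp oU => y _; exact: lsubmx_continuous.
by apply: open_comp oV => y _; exact: rsubmx_continuous.
Qed.

Lemma chart_cod_warped (i : chart W) : chart_cod W i = over U (chart_cod F i.2).
Proof.
apply/seteqP; split => [_ [[a b] [/= Ua Fb] <-]|y [Uy [b Fb yb]]].
  by split; rewrite ?row_mxKl ?row_mxKr //; exists b.
by exists (lsubmx y, b) => //=; rewrite yb hsubmxK.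
Qed.

Lemma overlap_warped (i j : chart W) : overlap W i j = over U (overlap F i.2 j.2).
Proof.
apply/seteqP; split => [_ [[a b] [[/= Ua Fb] [_ /= Fb']] <-]|y [Uy [b [Fb Fb'] yb]]].
  by split; rewrite ?row_mxKl ?row_mxKr //; exists b.
by exists (lsubmx y, b) => //=; rewrite yb hsubmxK.
Qed.

Lemma transition_warpedE (i j : chart W) (y : 'rV[R]_(n + m)) :
  transition W i j y = row_mx (lsubmx y) (transition F i.2 j.2 (rsubmx y)).
Proof. by []. Qed.

Lemma transition_warped_l (i j : chart W) (q : 'I_n) :
  (fun y => transition W i j y 0 (lshift m q)) = affine 'e_(lshift m q) 0.
Proof.
rewrite -coord_affine; apply/funext => y.
by rewrite transition_warpedE row_mxEl mxE.
Qed.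

Lemma transition_warped_r (i j : chart W) (q : 'I_m) :
  (fun y => transition W i j y 0 (rshift n q)) =
  (fun z => transition F i.2 j.2 z 0 q) \o rsubmx.
Proof. by apply/funext => y; rewrite transition_warpedE row_mxEr. Qed.

(** The base has only the identity chart, so a change of charts moves the fibre coordinates
    alone. *)
Lemma jacobian_warped (i j : chart W) (y : 'rV[R]_(n + m)) :
  jacobian_mx (transition W i j) y =
  block_mx 1%:M 0 0 (jacobian_mx (transition F i.2 j.2) (rsubmx y)).
Proof.
apply/matrixP => p q; rewrite mxE -(splitK q); case: (fintype.split q) => {}q /=.
  rewrite transition_warped_l; have [_ ->] := is_derive_affine 'e_(lshift m q) 0 y p.
  rewrite mxE eqxx /= -(splitK p); case: (fintype.split p) => {}p /=.
    by rewrite block_mxEul !mxE (inj_eq (@lshift_inj _ _)).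
  by rewrite block_mxEdl !mxE eq_rlshift.
rewrite transition_warped_r -(splitK p); case: (fintype.split p) => {}p /=.
  by rewrite derive_rsub0 block_mxEur mxE.
by rewrite derive_rsub block_mxEdr mxE.
Qed.

Lemma smooth_atlas_warped : open U -> smooth_atlas F -> smooth_atlas W.
Proof.
move=> oU [hF cF oF covF domF codF KF ccF pcF tF]; split.
- by apply: hausdorff_prod => //; exact: norm_hausdorff.
- by apply: second_countable_prod => //; exact: second_countable_rV.
- exact: open_setX.
- apply/seteqP; split => [[a b] [/= Ua]|[a b] [[t i] _ [/= Ua Fb]]].
    by rewrite covF => -[i _ Fb]; exists (tt, i).
  by split=> //; rewrite covF; exists i.
- by move=> i; exact: open_setX.
- by move=> i; rewrite chart_cod_warped; exact: over_open.
- by move=> [t i] [a b] [/= Ua Fb]; rewrite row_mxKl row_mxKr KF.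
- move=> [t i] [a b] [/= Ua Fb].
  have sc : {for (a, b), continuous (Defs.coord F i \o @snd 'rV[R]_n (ambient F))}.
    by apply: continuous_comp; [exact: cvg_snd|exact: ccF].
  exact: (@cvg_row_mx ('rV[R]_n * ambient F)%type R 1 n m fst _ (a, b) (@cvg_fst _ _ _ _ _) sc).
- move=> [t i] y; rewrite chart_cod_warped => -[/= Uy Fy].
  have pc : {for y, continuous (param F i \o @rsubmx R 1 n m)}.
    by apply: continuous_comp; [exact: rsubmx_continuous|exact: pcF].
  exact: cvg_pair (@lsubmx_continuous R 1 n m y) pc.
- move=> i j q k; rewrite overlap_warped -(splitK q).
  case: (fintype.split q) => {}q /=.
    by rewrite transition_warped_l; exact: Ck_on_affine.
  rewrite transition_warped_r.
  by apply: (Ck_on_subset _ (Ck_on_rsub n (tF i.2 j.2 q k))) => y [].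
Qed.

Variables (eps : 'rV[R]_n) (s : 'rV[R]_n -> R).
Hypothesis epsE : forall i, eps 0 i = 1 \/ eps 0 i = -1.
Hypothesis gbE : forall x, gb x = s x *: diag_mx eps.

Lemma metric_tensor_warped : open U -> smooth_atlas F -> metric_tensor F ->
  (forall x, U x -> 0 < s x) -> (forall x, U x -> f x != 0) ->
  smooth_on (over U setT) (s \o lsubmx) ->
  smooth_on (over U setT) (f \o lsubmx) ->
  metric_tensor W.
Proof.
move=> oU aF [smF symF ndF [nuF ixF] trF] s0 f0 ss sf.
have sub V : over U V `<=` over U setT by move=> y [].
have oD i : open (over U (chart_cod F i)).
  by apply: over_open => //; exact: atlas_cod_open aF i.
have dgu : diag_mx eps \in unitmx.
  rewrite unitmxE det_diag unitfE; apply/prodf_neq0 => i _.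
  by have [->|->] := epsE i; rewrite ?oppr_eq0 oner_eq0.
split.
- move=> i p q k; rewrite chart_cod_warped.
  rewrite -(splitK p) -(splitK q).
  case: (fintype.split p) => {}p; case: (fintype.split q) => {}q /=.
  + rewrite (_ : (fun x => _) = fun x => (s \o lsubmx) x * diag_mx eps p q).
      by apply: Ck_onM => //; [exact: Ck_on_subset (sub _) (ss k)|exact: Ck_on_cst].
    by apply/funext => y; rewrite block_mxEul gbE mxE.
  + rewrite (_ : (fun x => _) = fun=> 0); first exact: Ck_on_cst.
    by apply/funext => y; rewrite block_mxEur mxE.
  + rewrite (_ : (fun x => _) = fun=> 0); first exact: Ck_on_cst.
    by apply/funext => y; rewrite block_mxEdl mxE.
  + rewrite (_ : (fun x => _) = fun x => (f \o lsubmx) x * (f \o lsubmx) x *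
        ((fun z => metric F i.2 z p q) \o rsubmx) x).
      apply: Ck_onM => //.
        by apply: Ck_onM => //; exact: Ck_on_subset (sub _) (sf k).
      by apply: (Ck_on_subset _ (Ck_on_rsub n (smF i.2 p q k))) => y [].
    by apply/funext => y; rewrite block_mxEdr mxE.
- move=> i y; rewrite chart_cod_warped => -[Uy Fy] /=.
  by rewrite tr_block_mx !trmx0 gbE !linearZ /= tr_diag_mx symF.
- move=> i y; rewrite chart_cod_warped => -[Uy Fy] /=.
  rewrite unitmxE det_ublock unitrM -!unitmxE gbE !unitmxZ ?ndF ?dgu //.
    by rewrite unitfE sqrf_eq0 f0.
  by rewrite unitfE gt_eqF // s0.
(* Both [s] and the square of [f] are positive, so the two blocks keep the indices of [eps] and of
   the fibre metric. *)
- have := has_index_diag epsE; move: #|_| => nuB ixB.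
  exists (nuB + nuF)%N => i y; rewrite chart_cod_warped.
  move=> -[Uy Fy] /=; apply: has_index_block.
    by rewrite gbE; apply: has_index_scale; [exact: s0|exact: ixB].
  by apply: has_index_scale; [rewrite exprn_even_gt0 //= f0|exact: ixF].
- move=> i j y; rewrite overlap_warped => -[Uy Fy].
  rewrite jacobian_warped transition_warpedE /= row_mxKl row_mxKr.
  rewrite tr_block_mx !trmx0 trmx1 !mulmx_block !mulmx0 !mul0mx !addr0 !add0r.
  rewrite mul1mx mulmx1 (trF _ _ _ Fy).
  by rewrite -!(scalemxAl, scalemxAr) !mul0mx.
Qed.
End WarpedProduct.

(** * The explicit power-law solutions *)

Theorem theorem2p5 (R : realType) (n m : nat)
    (n_ge3 : (3 <= n)%N) (m_ge1 : (1 <= m)%N)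
    (eps alpha : 'rV[R]_n) (eps0 : R)
    (epsE : forall i, eps 0 i = 1 \/ eps 0 i = -1)
    (eps0E : eps0 = 1 \/ eps0 = -1)
    (alphaE : \sum_(i < n) eps 0 i * alpha 0 i ^+ 2 = eps0)
    (F : chart_data R m) (F_sr : semi_riemannian F) (F_flat : ricci_flat F)
    (k c1 c2 c3 c N : R)
    (k_gt0 : 0 < k) (c1_gt0 : 0 < c1) (c2_gt0 : 0 < c2) (c3_gt0 : 0 < c3) :
  let a := (n%:R - 2) * k - m%:R in
  let b := m%:R * (2 * k + 1) - (n%:R - 2) * k ^+ 2 in
  N = (a ^+ 2 - b) / (2 * (k + a)) ->
  k + a != 0 ->
  let xi (x : 'rV[R]_n) := \sum_(i < n) alpha 0 i * x 0 i in
  let f t := c1 * ((a - N) * t + c) `^ (- (1 / (a - N))) in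
  let h t := c2 * ((a - N) * t + c) `^ (- (N / (a - N))) in
  let phi t := c3 * ((a - N) * t + c) `^ (- (k / (a - N))) in
  let U := [set x | 0 < (a - N) * xi x + c] in
  let gbar x := (phi (xi x) ^+ 2)^-1 *: diag_mx eps in
  let B := euclidean_domain U gbar in
  let W := warped_product B (f \o xi) F in
  [/\ quasi_einstein W (fun p => h (xi p.1)) 1 0,
      [/\ smooth_fun B (f \o xi), smooth_fun B (h \o xi)
        & smooth_fun B (phi \o xi)],
      (forall x, U x -> [/\ 0 < f (xi x), 0 < h (xi x) & 0 < phi (xi x)]),
      (0 < k + a ->
        U = [set x | - ((2 * c * (k + a)) / (a ^+ 2 + b + 2 * k * a)) < xi x])
    & (k + a < 0 ->
        U = [set x | xi x < - ((2 * c * (k + a)) / (a ^+ 2 + b + 2 * k * a))])].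
Proof.
move=> a b NE ka0 xi f h phi U gbar B W.
pose S := a ^+ 2 + b + 2 * k * a.
have n2 : 0 <= n%:R - 2 :> R by rewrite subr_ge0 ler_nat ltnW.
have S0 : 0 < S.
  have -> : S = a ^+ 2 + (n%:R - 2) * k ^+ 2 + m%:R by rewrite /S /b /a; ring.
  by rewrite ltr_wpDl ?ltr0n // addr_ge0 ?sqr_ge0 // mulr_ge0 ?sqr_ge0.
have N2 : N * (2 * (k + a)) = a ^+ 2 - b.
  by rewrite NE divfK // mulf_neq0 // pnatr_eq0.
have lamS : (a - N) * (2 * (k + a)) = S by rewrite mulrBl N2 /S; ring.
have lam0 : a - N != 0.
  by apply: contraTneq S0 => l0; rewrite -lamS l0 mul0r ltxx.
(* Since [S] is positive, the sign of [k + a] decides on which side of the threshold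
   [- (2 * c * (k + a) / S)] the base of the powers is positive. *)
have uS t : ((a - N) * t + c) * (2 * (k + a)) = S * (t + 2 * c * (k + a) / S).
  rewrite mulrDl mulrAC lamS [RHS]mulrDr; congr (_ + _).
  by rewrite [S * _]mulrC divfK ?gt_eqF //; ring.
pose beta := (a - N) *: alpha.
have uE x : (a - N) * xi x + c = affine beta c x.
  rewrite /affine mulr_sumr; congr (_ + _); apply: eq_bigr => i _.
  by rewrite mxE mulrA.
(* On the product the same function is affine again, with gradient padded by zeros. *)
have uW y : affine (row_mx beta (0 : 'rV[R]_m)) c y = affine beta c (lsubmx y).
  rewrite /affine big_split_ord /= [X in _ + X + _]big1 ?addr0 => [|i _].
    by congr (_ + _); apply: eq_bigr => i _; rewrite row_mxEl [lsubmx _ _ _]mxE.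
  by rewrite row_mxEr mxE mul0r.
have U0 x : U x -> 0 < affine beta c x by rewrite -uE.
have oU : open U.
  rewrite (_ : U = affine beta c @^-1` [set t | 0 < t]).
    by apply: open_comp (@open_gt R 0) => x _; exact: affine_continuous.
  by apply/seteqP; split => x; rewrite /U /= uE.
have smoothU C s : smooth_on U (fun x => C * ((a - N) * xi x + c) `^ s).
  move=> l; under eq_fun do rewrite uE.
  exact: Ck_on_powR_affine.
have smoothW C s : smooth_on (over U (@setT 'rV[R]_m))
    ((fun x => C * ((a - N) * xi x + c) `^ s) \o lsubmx).
  move=> l; rewrite /comp; under eq_fun do rewrite uE -uW.
  apply: Ck_on_powR_affine; first by apply: over_open => //; exact: openT.
  by move=> y [Uy _]; rewrite uW; exact: U0.
have pos C s x : 0 < C -> U x -> 0 < C * ((a - N) * xi x + c) `^ s.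
  by move=> C0 Ux; rewrite mulr_gt0 // powR_gt0.
have powR_sq (t s : R) : (t `^ s) ^+ 2 = t `^ (s * 2).
  by rewrite powRrM powR_mulrn // powR_ge0.
have sE x : U x -> (phi (xi x) ^+ 2)^-1 =
    c3 ^- 2 * ((a - N) * xi x + c) `^ (2 * k / (a - N)).
  move=> Ux; rewrite exprMn invfM powR_sq -powRN.
  by congr (_ * _ `^ _); field.
have fE x : U x -> f (xi x) ^+ 2 =
    c1 ^+ 2 * ((a - N) * xi x + c) `^ (- 2 / (a - N)).
  move=> Ux; rewrite exprMn powR_sq.
  by congr (_ * _ `^ _); field.
have [aF mF] := F_sr.
have aW : smooth_atlas W by exact: smooth_atlas_warped.
have mW : metric_tensor W.
  apply: (@metric_tensor_warped _ _ _ _ _ _ _ eps (fun x => (phi (xi x) ^+ 2)^-1)) => //.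
  - by move=> x Ux; rewrite invr_gt0 exprn_gt0 // pos.
  - by move=> x Ux; rewrite gt_eqF // pos.
  - move=> l; apply: Ck_on_eq (smoothW (c3 ^- 2) (2 * k / (a - N)) l).
      by apply: over_open => //; exact: openT.
    by move=> y [Uy _]; rewrite /= sE.
  - exact: smoothW.
split.
- split=> //.
  + move=> i l; rewrite chart_cod_warped.
    by apply: Ck_on_subset (smoothW c2 (- (N / (a - N))) l) => y [].
  + by move=> p [Up _]; rewrite gt_eqF // pos.
  + move=> i x Dx; rewrite scale0r.
    have Dx' : over U (chart_cod F i.2) x by move: Dx; rewrite chart_cod_warped.
    (* This fixes the parameters, with lam = a - N: p0 = c3^-2, mu = 2k/lam, w0 = c1^2, nu = -2/lam.
       Hence kp = k/lam, th = -1/lam and T = (nk - m)/lam; [hE] gives eta = -N/lam. *)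
    have metricE y : over U (chart_cod F i.2) y -> metric W i y =
        block_mx ((c3 ^- 2 * affine (row_mx beta 0) c y `^ (2 * k / (a - N)))
                    *: diag_mx eps) 0
                 0 ((c1 ^+ 2 * affine (row_mx beta 0) c y `^ (- 2 / (a - N)))
                    *: metric F i.2 (rsubmx y)).
      by move=> [Uy _]; rewrite uW -!uE -sE // -fE.
    have hE y : over U (chart_cod F i.2) y ->
        ((fun p => h (xi p.1)) \o param W i) y =
        c2 * affine (row_mx beta 0) c y `^ (- (N / (a - N))).
      by move=> _; rewrite uW -uE.
    apply: (quasi_einstein_warped_power _ _ _ _ _ _ _ _ metricE hE Dx') => //.
    * by move=> j; have [->|->] := epsE j; rewrite ?mulrNN mulr1.
    * by rewrite invr_eq0 expf_neq0 // gt_eqF.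
    * by rewrite expf_neq0 // gt_eqF.
    * by apply: over_open => //; exact: atlas_cod_open aF i.2.
    * by move=> y [Uy _]; rewrite uW; exact: U0.
    * by move=> y [_ Fy]; exact: (Defs.metric_sym mF Fy).
    * by move=> y [_ Fy]; exact: (metric_nondegenerate mF Fy).
    * move=> y [_ Fy] p q s; have [_ /(_ s)[dg _]] := metric_smooth mF i.2 p q 1.
      exact: dg.
    * by rewrite gt_eqF.
    * by apply: F_flat; have [] := Dx'.
    (* The zero is written as the value that the coefficient of [beta_i beta_j] takes for these
       parameters, before the choice of [N] is used. *)
    * have -> : 0 = (a ^+ 2 - b - N * (2 * (k + a))) / (a - N) ^+ 2.
        by rewrite N2 subrr mul0r.
      by rewrite /b /a; field.
    (* After multiplication by lam this reads nk - m - N = lam + 2k, which is the definition of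
       [a]. *)
    * by rewrite /a; field.
- by split; move=> i; rewrite /chart_cod /= image_id; exact: smoothU.
- by move=> x Ux; rewrite !pos.
- move=> ka; apply/funext => x; apply/propext; rewrite /U /=.
  have ka2 : 0 < 2 * (k + a) by rewrite mulr_gt0.
  by rewrite -(pmulr_lgt0 _ ka2) uS pmulr_rgt0 // -[X in _ <-> is_true X]subr_gt0 opprK.
- move=> ka; apply/funext => x; apply/propext; rewrite /U /=.
  have ka2 : 2 * (k + a) < 0 by rewrite pmulr_rlt0.
  by rewrite -(nmulr_llt0 _ ka2) uS pmulr_rlt0 // -[X in _ <-> is_true X]subr_lt0 opprK.
Qed.
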